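(* Let $(X,\mathcal{X},\mu,T)$ be a non-atomic invertible ergodic measure-preserving system. Then for every $\varepsilon>0$ there is a measurable set $A\in\mathcal{X}$ with $\mu(A)<\varepsilon$ such that for $\mu$-almost every $x\in X$, \[ \limsup_{N\to\infty}\frac{1}{N^2}\sum_{1\le m,n\le N}\mathbf{1}_A(T^{\Omega(m^2+n^2)}x)=1 \] and \[ \liminf_{N\to\infty}\frac{1}{N^2}\sum_{1\le m,n\le N}\mathbf{1}_A(T^{\Omega(m^2+n^2)}x)=0. \]
   Context: $\Omega(n)$ is the number of prime factors of the positive integer $n$ counted with multiplicity; $m,n$ denote positive integers. A measure-preserving system is a quadruple $(X,\mathcal{X},\mu,T)$ with $(X,\mathcal{X},\mu)$ a probability space and $T\colon X\to X$ measurable with $\mu(T^{-1}A)=\mu(A)$ for all $A\in\mathcal{X}$; by standing convention $X$ is a compact metric space, $\mathcal{X}$ its Borel $\sigma$-algebra and $\mu$ a Borel probability measure. It is invertible if $T$ is invertible with measurable inverse, and ergodic if $A=T^{-1}A$, $A\in\mathcal{X}$, implies $\mu(A)\in\{0,1\}$. Non-atomic means $\mu(\{x\})=0$ for all $x\in X$. *)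

(* Defs.v *)
From HB Require Import structures.
From mathcomp Require Import all_boot all_order all_algebra.
From mathcomp Require Import all_classical all_reals all_analysis.

Set Implicit Arguments.
Unset Strict Implicit.
Unset Printing Implicit Defensive.

Local Open Scope classical_set_scope.
Local Open Scope ring_scope.

(* A metric space carrying a sigma-algebra; the two are related only by the
   hypothesis [borel_space] below. *)
#[short(type="metricMeasurableType")]
HB.structure Definition MetricMeasurable (d : measure_display)
    (R : numDomainType) :=
  {X of Metric R X & Measurable d X}.

Definition borel_space (d : measure_display) (R : numDomainType)
    (X : metricMeasurableType d R) : Prop :=
  @measurable d X = <<s @open X >>.

(* The sum of the multiplicities; [primes n] is duplicate-free. *)
Definition Omega (n : nat) : nat := (\sum_(p <- primes n) logn p n)%N.

Section dynamics.
Context {d : measure_display} {X : measurableType d} {R : realType}.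
Implicit Types (mu : probability X R) (T : X -> X).

Definition measure_preserving mu T : Prop :=
  measurable_fun [set: X] T /\
  forall A : set X, measurable A -> mu (T @^-1` A) = mu A.

Definition invertible T : Prop :=
  exists S : X -> X,
    [/\ cancel T S, cancel S T & measurable_fun [set: X] S].

Definition ergodic mu T : Prop :=
  forall A : set X, measurable A -> T @^-1` A = A ->
    mu A = 0%E \/ mu A = 1%E.

Definition nonatomic mu : Prop := forall x : X, mu [set x] = 0%E.

Definition Omega_average T (A : set X) (x : X) (N : nat) : R :=
  (N%:R ^+ 2)^-1 *
  \sum_(1 <= m < N.+1) \sum_(1 <= n < N.+1)
     \1_A (iter (Omega (m ^ 2 + n ^ 2)%N) T x).

End dynamics.

(* Main.v *)
Require Import Defs.
From mathcomp Require Import all_boot all_order all_algebra.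
From mathcomp Require Import all_classical all_reals all_analysis.
From mathcomp Require Import ring lra zify.

(** The times Omega (m ^ 2 + n ^ 2) obey a law of large numbers: for all but a small
    proportion of the pairs m, n <= N they lie within a factor 1 + o(1) of one
    number, [mean_lines], and as N varies this number comes within 1 of every
    large integer t.  Averaging along these times is thus, up to a small error,
    averaging over a window of length o(t) around t, for a t of one's choice
    ([Omega_sum_sqr_normal_order]).

    Averages over such windows sweep out.  Let B be a tiny set of positive
    measure; by ergodicity almost every orbit hits B.  The residue modulo H of
    the first hitting time cuts the space into H levels, and T lowers a positive
    level by one.  Let W consist of the w lowest levels, with w small
    compared with H but larger than the windows.  A point of level r >= w
    spends a whole window around a time t slightly below r inside W, although
    mu W is of order w / H ([sweeping_set]).

    Take such sets W k of measure at most e k, with e k decreasing so fast that the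
    union of all W j with j > k is almost never met during the times on which W k acts,
    and let A be the set of points whose last W k has an even index ([glued]).
    By Borel-Cantelli almost every x has, for every large k, an average of at
    least 1 - e k if k is even and of at most e k if k is odd.

    The law of large numbers is a second moment argument in the manner of Turan.
    If p = 1 mod 4, then p divides m ^ 2 + n ^ 2 exactly if (m, n) lies modulo p
    on one of the two lines m = i n, m = - i n, where i ^ 2 = -1.  For a fixed n each line
    is one residue class of m, and by the Chinese remainder theorem the classes
    for different primes are nearly independent.  Hence the number of incidences
    with primes p <= z has variance of the order of its mean
    ([line_count_variance]), and that mean, twice the sum of 1 / p, is unbounded
    ([prime_1mod4_diverges]).  Outside a small exceptional set of pairs Omega
    differs from this number by a bounded amount ([Omega_line_count]): with
    N = z ^ 4 at most 9 prime factors exceed z, squares of primes above Y are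
    rare, and primes up to Y contribute O(1). A prime p = 3 mod 4 divides
    m ^ 2 + n ^ 2 only together with p ^ 2, so it falls under the rare squares. *)

Set Implicit Arguments.
Unset Strict Implicit.
Unset Printing Implicit Defensive.
Import Order.TTheory GRing.Theory Num.Theory.

Local Open Scope ring_scope.

(** * Euler products and the character modulo 4 *)

Lemma ler_sum_term (R : realFieldType) (n : nat) (P : pred nat) (F : nat -> R)
    (i0 : nat) :
  (forall i, P i -> 0 <= F i) -> (i0 < n)%N -> P i0 ->
  F i0 <= \sum_(i < n | P i) F i.
Proof.
move=> F0 i0n Pi0; rewrite (bigD1 (Ordinal i0n)) //= lerDl.
by apply: sumr_ge0 => i /andP[/F0].
Qed.

(** Expanding the product produces each admissible term g n at least once, from
    k = logn p n for each p, and all other terms are nonnegative.  The bound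
    k <= N loses nothing because p ^ k <= n forces k < n. *)
Lemma euler_sum_le (R : realFieldType) (g : nat -> R) (a : nat -> nat -> R) :
  (forall n, 0 <= g n) -> (forall p k, 0 <= a p k) -> g 1%N = 1 ->
  (forall p k m, prime p -> (0 < m)%N -> ~~ (p %| m)%N ->
     g (p ^ k * m)%N = a p k * g m) ->
  forall (ps : seq nat) (N : nat), all prime ps ->
    \sum_(n < N.+1 | (0 < n)%N && all (mem ps) (primes n)) g n
      <= \prod_(p <- ps) \sum_(k < N.+1) a p k.
Proof.
move=> g0 a0 g1 gM ps N; elim: ps => [_|p ps IH /= /andP[pp psp]].
  rewrite big_nil.
  have E (n : 'I_N.+1) : (0 < n)%N && all (mem [::]) (primes n) -> n = 1%N :> nat.
    move=> /andP[n0]; case: (posnP n.-1) => [|n1]; first by lia.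
    have: pdiv n \in primes n.
      by rewrite mem_primes pdiv_prime ?n0 ?pdiv_dvd //; lia.
    by case: (primes n).
  case: N E => [|N] E.
    by rewrite big_mkcond big_ord_recl big_ord0 /= addr0 ler01.
  rewrite big_mkcond (bigD1 (Ordinal (isT : (1 < N.+2)%N))) //= big1 ?addr0 ?g1 //.
  move=> i i1; case: ifP => // /E ei; case/negP: i1; apply/eqP; exact: val_inj.
rewrite big_cons mulr_suml.
pose Q n := (0 < n)%N && all (mem ps) (primes n).
apply: (@le_trans _ _ (\sum_(n < N.+1) \sum_(k < N.+1) \sum_(m < N.+1 | Q m)
   (n == p ^ k * m :> nat)%N%:R * (a p k * g m))).
  rewrite big_mkcond; apply: ler_sum => n _.
  have t0 k m : 0 <= (n == p ^ k * m :> nat)%N%:R * (a p k * g m).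
    by rewrite mulr_ge0 // mulr_ge0.
  case: ifP => [/andP[n0 sm]|_]; last first.
    by apply: sumr_ge0 => k _; apply: sumr_ge0.
  have [m pm En] := pfactor_coprime pp n0.
  set k := logn p n in En.
  have m0 : (0 < m)%N by move: n0; rewrite En muln_gt0 => /andP[].
  have mn : (m <= n)%N by rewrite En leq_pmulr // expn_gt0 prime_gt0.
  have kn : (k < n)%N by apply: leq_trans (ltn_expl k (prime_gt1 pp)) _; rewrite En leq_pmull.
  have nN := ltn_ord n.
  have Qm : Q m.
    rewrite /Q m0; apply/allP => q qm; rewrite !inE.
    have /(allP sm) : q \in primes n.
      move: qm; rewrite !mem_primes n0 m0 => /andP[-> /= qm].
      by rewrite En dvdn_mulr.
    rewrite !inE => /orP[/eqP qp|//].
    by move: qm pm; rewrite qp mem_primes pp m0 /= prime_coprime // => ->.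
  pose F k := \sum_(m < N.+1 | Q m) (n == p ^ k * m :> nat)%N%:R * (a p k * g m).
  apply: (@le_trans _ _ (F k)); last first.
    apply: (@ler_sum_term _ _ xpredT F) => // [i _|]; first exact: sumr_ge0.
    exact: ltn_trans kn nN.
  pose G m := (n == p ^ k * m :> nat)%N%:R * (a p k * g m).
  apply: (@le_trans _ _ (G m)); last first.
    apply: (@ler_sum_term _ _ Q G) => // [i _|]; first exact: t0.
    exact: leq_ltn_trans mn nN.
  by rewrite /G En mulnC eqxx mul1r gM // -prime_coprime.
rewrite exchange_big /=; apply: ler_sum => k _.
rewrite exchange_big /=.
apply: (@le_trans _ _ (\sum_(m < N.+1 | Q m) a p k * g m)); last first.
  by rewrite -mulr_sumr; apply: ler_wpM2l => //; exact: IH.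
apply: ler_sum => m _; rewrite -mulr_suml ler_piMl ?mulr_ge0 //.
case: (ltnP (p ^ k * m) N.+1) => [h|h].
  rewrite (bigD1 (Ordinal h)) //= eqxx big1 ?addr0 // => i.
  by rewrite -val_eqE /= => /negbTE ->.
rewrite big1 ?ler01 // => i _; case: eqP => // E.
by move: (ltn_ord i); rewrite E; lia.
Qed.

Definition prime_1mod4 (p : nat) : bool := prime p && (p %% 4 == 1)%N.

(** The nonprincipal Dirichlet character modulo 4. *)
Definition chi4 (R : realFieldType) (n : nat) : R :=
  (n %% 4 == 1)%N%:R - (n %% 4 == 3)%N%:R.
Arguments chi4 : clear implicits.

Lemma chi4M (R : realFieldType) a b : chi4 R (a * b) = chi4 R a * chi4 R b.
Proof.
rewrite /chi4 -modnMm.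
have := ltn_pmod a (isT : (0 < 4)%N); have := ltn_pmod b (isT : (0 < 4)%N).
by case: (a %% 4)%N => [|[|[|[|//]]]]; case: (b %% 4)%N => [|[|[|[|//]]]] _ _;
  rewrite /=; lra.
Qed.

Lemma chi4X (R : realFieldType) a k : chi4 R (a ^ k) = chi4 R a ^+ k.
Proof.
elim: k => [|k IH]; first by rewrite expn0 expr0 /chi4 /= subr0.
by rewrite expnS exprS chi4M IH.
Qed.

(** For n > 0, a quarter of the number of representations of n as a sum of two
    squares. *)
Definition chi4_divisor_sum (R : realFieldType) (n : nat) : R :=
  \sum_(d <- divisors n) chi4 R d.
Arguments chi4_divisor_sum : clear implicits.

(** A divisor of p ^ k.+1 * m that does not divide p ^ k * m carries the full
    power p ^ k.+1. *)
Lemma perm_divisors_pfactor p k m : prime p -> (0 < m)%N -> ~~ (p %| m)%N ->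
  perm_eq (divisors (p ^ k.+1 * m))
    (divisors (p ^ k * m) ++ [seq (p ^ k.+1 * d)%N | d <- divisors m]).
Proof.
move=> pp m0 pm; have p0 := prime_gt0 pp.
have cpm e : (e %| m)%N -> ~~ (p %| e)%N by move=> em; apply: contra pm => /dvdn_trans; apply.
apply: uniq_perm; rewrite ?divisors_uniq ?cat_uniq ?divisors_uniq //=.
  rewrite map_inj_uniq ?divisors_uniq ?andbT; last first.
    by move=> x y /eqP; rewrite eqn_pmul2l ?expn_gt0 ?p0 // => /eqP.
  apply/hasPn => _ /mapP[d dm ->]; rewrite -dvdn_divisors ?muln_gt0 ?expn_gt0 ?p0 //=.
  rewrite expnSr -mulnA dvdn_pmul2l ?expn_gt0 ?p0 //.
  by apply: contra pm; apply: dvdn_trans; exact: dvdn_mulr.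
move=> d; rewrite mem_cat -!dvdn_divisors ?muln_gt0 ?expn_gt0 ?p0 //.
apply/idP/orP => [dd|[dd|/mapP[e em ->]]]; last 2 first.
- by apply: dvdn_trans dd _; rewrite dvdn_mul // dvdn_exp2l.
- by rewrite dvdn_mul // dvdn_divisors.
have d0 : (0 < d)%N by apply: dvdn_gt0 dd; rewrite muln_gt0 expn_gt0 p0.
have [e pe Ed] := pfactor_coprime pp d0.
have em : (e %| m)%N.
  have : (e %| p ^ k.+1 * m)%N by apply: dvdn_trans dd; rewrite Ed dvdn_mulr.
  by rewrite Gauss_dvdr // coprimeXr // coprime_sym.
case: (leqP (logn p d) k) => [lk|kl].
  by left; rewrite Ed mulnC dvdn_mul // dvdn_exp2l.
right; have lE : logn p d = k.+1.
  apply/eqP; rewrite eqn_leq kl andbT.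
  have : (p ^ logn p d %| p ^ k.+1 * m)%N by apply: dvdn_trans dd; rewrite {2}Ed dvdn_mull.
  rewrite Gauss_dvdl; first by rewrite dvdn_Pexp2l // prime_gt1.
  by rewrite coprimeXl // prime_coprime.
apply/mapP; exists e; first by rewrite -dvdn_divisors.
by rewrite {1}Ed lE mulnC.
Qed.

Lemma chi4_divisor_sum_pfactor (R : realFieldType) p k m :
  prime p -> (0 < m)%N -> ~~ (p %| m)%N ->
  chi4_divisor_sum R (p ^ k * m) =
  (\sum_(i < k.+1) chi4 R p ^+ i) * chi4_divisor_sum R m.
Proof.
move=> pp m0 pm; elim: k => [|k IH].
  by rewrite expn0 mul1n big_ord_recl big_ord0 expr0 addr0 mul1r.
rewrite {1}/chi4_divisor_sum (perm_big _ (perm_divisors_pfactor k pp m0 pm)) big_cat /=.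
rewrite -/(chi4_divisor_sum R _) IH big_map [in RHS]big_ord_recr /= mulrDl; congr (_ + _).
by rewrite mulr_sumr; apply: eq_bigr => d _; rewrite chi4M chi4X.
Qed.

Lemma sum_chi4_ge0 (R : realFieldType) p k : 0 <= \sum_(i < k.+1) chi4 R p ^+ i.
Proof.
have := ltn_pmod p (isT : (0 < 4)%N); rewrite /chi4.
case: (p %% 4)%N => [|[|[|[|//]]]] _ /=; rewrite ?subrr ?subr0 ?sub0r.
- by apply: sumr_ge0 => i _; rewrite exprn_ge0.
- by apply: sumr_ge0 => i _; rewrite exprn_ge0.
- by apply: sumr_ge0 => i _; rewrite exprn_ge0.
rewrite (_ : \sum_(i < k.+1) _ = (~~ odd k)%:R) ?ler0n //.
elim: k => [|k IH]; first by rewrite big_ord_recl big_ord0 expr0 addr0.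
by rewrite big_ord_recr /= IH -signr_odd /=; case: (odd k) => /=; rewrite ?expr0 ?expr1; lra.
Qed.

(** Splitting off one prime power at a time reduces the claim to
    [sum_chi4_ge0]. *)
Lemma chi4_divisor_sum_ge0 (R : realFieldType) n : 0 <= chi4_divisor_sum R n.
Proof.
elim/ltn_ind: n => n IH.
case: (leqP n 1) => [|n1].
  case: n {IH} => [|[|//]] _; rewrite /chi4_divisor_sum /divisors /= big_cons big_nil /chi4 /=; lra.
have pp := pdiv_prime n1; have n0 : (0 < n)%N by lia.
have [m pm En] := pfactor_coprime pp n0.
have m0 : (0 < m)%N by move: n0; rewrite En muln_gt0 => /andP[].
rewrite En mulnC chi4_divisor_sum_pfactor -?prime_coprime //.
rewrite mulr_ge0 ?sum_chi4_ge0 // IH // [ltnRHS]En ltn_Pmulr //.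
have l0: (0 < logn (pdiv n) n)%N by rewrite logn_gt0 mem_primes pp n0 pdiv_dvd.
by apply: leq_trans (ltn_expl _ (prime_gt1 pp)); lia.
Qed.

(** The nonzero terms 1, - 1/3, 1/5, ... alternate and decrease in size, so no
    partial sum falls below 1 - 1/3.  In the limit this is the positivity
    of L(1, chi4). *)
Lemma chi4_partial_sum_ge (R : realFieldType) y : (0 < y)%N ->
  2 / 3 <= \sum_(d < y.+1) chi4 R d / d%:R.
Proof.
pose A y := \sum_(d < y.+1) chi4 R d / d%:R; rewrite -/(A y).
have AS y' : A y'.+1 = A y' + chi4 R y'.+1 / y'.+1%:R by rewrite /A big_ord_recr.
have cE k j : chi4 R (4 * k + j) = chi4 R j by rewrite /chi4 mulnC modnMDl.
have A0 : A 0%N = 0 by rewrite /A big_ord_recl big_ord0 /chi4 /= subrr mul0r addr0.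
have AD k j : A (4 * k + j.+1)%N = A (4 * k + j)%N + chi4 R j.+1 / (4 * k + j.+1)%:R.
  by rewrite addnS AS -addnS cE.
have A1 k : A (4 * k + 1)%N = A (4 * k)%N + ((4 * k + 1)%:R)^-1.
  by rewrite AD addn0 /chi4 /= subr0 mul1r.
have A2 k : A (4 * k + 2)%N = A (4 * k + 1)%N.
  by rewrite AD /chi4 /= subr0 mul0r addr0.
have A3 k : A (4 * k + 3)%N = A (4 * k + 2)%N - ((4 * k + 3)%:R)^-1.
  by rewrite AD /chi4 /= sub0r mulN1r.
have A4 k : A (4 * k.+1)%N = A (4 * k + 3)%N.
  by rewrite mulnSr AD /chi4 /= subr0 mul0r addr0.
(* In each block of four only the residues 1 and 3 contribute. *)
have step k : A (4 * k)%N <= A (4 * k + 3)%N.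
  rewrite A3 A2 A1 -addrA lerDl subr_ge0 lef_pV2 ?posrE ?ltr0n ?addn_gt0 ?orbT //.
  by rewrite ler_nat leq_add2l.
have A3k k : 2 / 3 <= A (4 * k + 3)%N.
  elim: k => [|k IH]; last by apply: le_trans (step _); rewrite A4.
  by rewrite A3 A2 A1 !muln0 A0 !add0n; lra.
have A1k k : 2 / 3 <= A (4 * k + 1)%N.
  have := A3k k; rewrite A3 A2 => /le_trans; apply.
  by rewrite lerBlDr lerDl invr_ge0 ler0n.
move=> y0; have Ey := divn_eq y 4; rewrite mulnC in Ey.
have := ltn_pmod y (isT : (0 < 4)%N).
case: (y %% 4)%N Ey => [|[|[|[|//]]]] Ey _; rewrite Ey.
- case: (y %/ 4)%N Ey => [|k] Ey; first by lia.
  by rewrite addn0 A4.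
- exact: A1k.
- by rewrite A2.
- exact: A3k.
Qed.

Lemma sum_pair_eq (R : realFieldType) (N d n : nat) (c : R) :
  (0 < n <= N)%N ->
  \sum_(b < N.+1) (n == d * b :> nat)%N%:R * c = (d %| n)%N%:R * c.
Proof.
move=> /andP[n0 nN]; rewrite -mulr_suml; congr (_ * c).
have [/dvdnP[b Eb]|dn] := boolP (d %| n)%N; last first.
  rewrite big1 // => b _; case: eqP => // Eb.
  by move: dn; rewrite Eb dvdn_mulr.
have d0 : (0 < d)%N by move: n0; rewrite Eb muln_gt0 => /andP[].
have bN : (b < N.+1)%N.
  by rewrite ltnS (leq_trans _ nN) // Eb leq_pmulr.
rewrite (bigD1 (Ordinal bN)) //= {1}Eb mulnC eqxx big1 ?addr0 // => i.
by rewrite -val_eqE /= Eb mulnC eqn_pmul2l // eq_sym => /negbTE ->.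
Qed.

Lemma chi4_divisor_sumE (R : realFieldType) (N n : nat) : (0 < n <= N)%N ->
  chi4_divisor_sum R n = \sum_(d < N.+1) (d %| n)%N%:R * chi4 R d.
Proof.
move=> /andP[n0 nN].
rewrite -(big_mkord xpredT (fun d => (d %| n)%N%:R * chi4 R d)) /chi4_divisor_sum.
rewrite [RHS](eq_bigr (fun d => if (d %| n)%N then chi4 R d else 0)); last first.
  by move=> d _; case: ifP => _; rewrite ?mul1r ?mul0r.
rewrite -big_mkcond -[RHS]big_filter; apply: perm_big; apply: uniq_perm.
- exact: divisors_uniq.
- by rewrite filter_uniq // iota_uniq.
move=> d; rewrite mem_filter -dvdn_divisors // mem_index_iota /=.
by case: (boolP (d %| n)%N) => //= /dvdn_leq -/(_ n0); lia.
Qed.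

(** Writing n = d * b and summing over d first leaves, for each b, a partial sum
    of L(1, chi4) up to N / b. *)
Lemma sum_chi4_divisor_sum_ge (R : realFieldType) (N : nat) :
  2 / 3 * \sum_(b < N.+1) (b%:R)^-1 <=
  \sum_(n < N.+1 | (0 < n)%N) chi4_divisor_sum R n / n%:R.
Proof.
have -> : \sum_(n < N.+1 | (0 < n)%N) chi4_divisor_sum R n / n%:R =
  \sum_(b < N.+1) \sum_(d < N.+1) \sum_(n < N.+1 | (0 < n)%N)
     (n == d * b :> nat)%N%:R * (chi4 R d / (d * b)%:R).
  rewrite exchange_big /= [RHS](eq_bigr (fun d : 'I_N.+1 => \sum_(n < N.+1 | (0 < n)%N)
    \sum_(b < N.+1) (n == d * b :> nat)%N%:R * (chi4 R d / n%:R))); last first.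
    move=> d _; rewrite exchange_big /=; apply: eq_bigr => n _; apply: eq_bigr => b _.
    by case: eqP => [->|]; rewrite ?mul0r.
  rewrite exchange_big /=; apply: eq_bigr => n n0.
  have nN : (0 < n <= N)%N by rewrite n0 -ltnS /=.
  rewrite (chi4_divisor_sumE _ nN) mulr_suml; apply: eq_bigr => d _.
  by rewrite sum_pair_eq // mulrA.
rewrite mulr_sumr; apply: ler_sum => b _.
case: (posnP b) => [->|b0].
  rewrite invr0 mulr0 big1 // => d _; rewrite big1 // => n /lt0n_neq0/negbTE.
  by rewrite muln0 => ->; rewrite mul0r.
have bN : (0 < N %/ b)%N by rewrite divn_gt0 // -ltnS.
rewrite (eq_bigr (fun d : 'I_N.+1 => (if (d < (N %/ b).+1)%N then chi4 R d / d%:R else 0) * (b%:R)^-1)).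
  rewrite -mulr_suml ler_wpM2r ?invr_ge0 ?ler0n //.
  rewrite -big_mkcond -(big_ord_widen _ (fun d => chi4 R d / d%:R)) ?ltnS ?leq_div //.
  exact: chi4_partial_sum_ge.
move=> d _; rewrite ltnS leq_divRL //.
case: (posnP d) => [->|d0].
  by rewrite /chi4 /= subrr !mul0r ?if_same ?mul0r big1 // => n _; rewrite mulr0.
case: ifP => h.
  have h' : (d * b < N.+1)%N by [].
  rewrite (bigD1 (Ordinal h')) ?muln_gt0 ?d0 //= eqxx big1 ?addr0.
    by rewrite mul1r natrM invfM mulrA.
  by move=> i /andP[_]; rewrite -val_eqE /= => /negbTE ->; rewrite mul0r.
rewrite mul0r big1 // => n _; case: eqP => E; rewrite ?mul0r //.
by move: (ltn_ord n); rewrite E ltnS h.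
Qed.

(** * The primes congruent to 1 modulo 4 *)

(** Telescoping, as 1 / (n + 1) ^ 2 <= 1 / n - 1 / (n + 1). *)
Lemma sum_inv_sqr_le (R : realFieldType) (Y z : nat) : (0 < Y)%N -> (Y <= z)%N ->
  \sum_(Y <= n < z) (n.+1%:R ^+ 2)^-1 <= Y%:R^-1 - z%:R^-1 :> R.
Proof.
move=> Y0 /subnK <-; elim: (z - Y)%N => [|k IH]; first by rewrite add0n big_geq ?subrr.
rewrite addSn big_nat_recr ?leq_addl //=; set n := (k + Y)%N in IH *.
have n0 : 0 < n%:R :> R by rewrite ltr0n /n; lia.
apply: (@le_trans _ _ ((Y%:R^-1 - n%:R^-1) + (n%:R^-1 - n.+1%:R^-1))); last by rewrite addrA subrK.
rewrite lerD // -natr1 -subr_ge0.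
have -> : n%:R^-1 - (n%:R + 1)^-1 - ((n%:R + 1) ^+ 2)^-1 = (n%:R * (n%:R + 1) ^+ 2)^-1 :> R.
  by field; rewrite ?lt0r_neq0 //; lra.
by rewrite invr_ge0 mulr_ge0 ?sqr_ge0 // ltW.
Qed.

(** The full power series would give equality.  Truncation leaves the error term
    x ^ N.+1 * (1 + (1 - x) * c * a N) with a N the inner sum at k = N, and it
    has the right sign because c * a N = a N.+1 - 1 >= -1. *)
Lemma euler_factor_le (R : realFieldType) (p N : nat) (x : R) : 0 < x < 1 ->
  (1 - x) * (1 - chi4 R p * x) *
    \sum_(k < N.+1) (\sum_(i < k.+1) chi4 R p ^+ i) * x ^+ k <= 1.
Proof.
move=> /andP[x0 x1]; set c := chi4 R p; pose a k := \sum_(i < k.+1) c ^+ i.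
rewrite -[X in _ * X <= _]/(\sum_(k < N.+1) a k * x ^+ k).
have aS k : a k.+1 = 1 + c * a k.
  rewrite /a big_ord_recl expr0 mulr_sumr; congr (_ + _).
  by apply: eq_bigr => i _; rewrite -exprS.
have E : (1 - x) * (1 - c * x) * (\sum_(k < N.+1) a k * x ^+ k) =
    1 - x ^+ N.+1 * (1 + (1 - x) * (c * a N)).
  elim: (N) => [|k IH].
    by rewrite big_ord_recl big_ord0 addr0 /a big_ord_recl big_ord0 !expr0 addr0 expr1; ring.
  by rewrite big_ord_recr /= mulrDr IH aS !exprS; ring.
rewrite E lerBlDr lerDl mulr_ge0 ?exprn_ge0 ?ltW //.
have := sum_chi4_ge0 R p N.+1; rewrite -/(a N.+1) aS => h; nra.
Qed.

Section divergence.
Context {R : realType}.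

(** The factor is at most (1 - x)^-2, (1 - x ^ 2)^-1 or (1 - x)^-1 with
    x = 1 / p, according as p is 1 or 3 modulo 4 or p = 2; in the last two cases
    this is at most 1 + 4 / p ^ 2. *)
Lemma euler_factor_le_exp (p N : nat) : prime p ->
  \sum_(k < N.+1) (\sum_(i < k.+1) chi4 R p ^+ i) / (p ^ k)%:R <=
  expR (4 * (prime_1mod4 p)%:R / p%:R + 4 / p%:R ^+ 2).
Proof.
move=> pp; rewrite /prime_1mod4 pp /=; set x : R := p%:R^-1.
have p1 := prime_gt1 pp.
have x0 : 0 < x by rewrite invr_gt0 ltr0n; lia.
have x2 : x <= 1 / 2.
  by rewrite div1r lef_pV2 ?posrE ?ltr0n ?(ler_nat _ 2 p) //; lia.
have := @euler_factor_le R p N x; rewrite x0 (le_lt_trans x2) //=; last by lra.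
move=> /(_ isT).
rewrite (eq_bigr (fun k : 'I_N.+1 => (\sum_(i < k.+1) chi4 R p ^+ i) / (p ^ k)%:R)); last first.
  by move=> k _; rewrite natrX exprVn.
set S := \sum_(k < _) _ => hS.
apply: le_trans (expR_ge1Dx _).
rewrite -exprVn -/x.
suff : 1 <= (1 + (4 * (p %% 4 == 1)%N%:R * x + 4 * x ^+ 2)) * ((1 - x) * (1 - chi4 R p * x)).
  move=> h; set P := (1 - x) * _ in h hS; set U := 1 + _ in h *.
  have U1 : 1 <= U.
    by rewrite /U lerDl addr_ge0 // ?mulr_ge0 ?exprn_ge0 // ?ltW.
  have P0 : 0 < P by rewrite -(pmulr_rgt0 _ (lt_le_trans ltr01 U1)); apply: lt_le_trans h.
  by rewrite -(ler_pM2l P0) (mulrC P U); apply: le_trans h.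
have [p2|op] := even_prime pp.
  by rewrite /x p2 /chi4 /=; lra.
have := ltn_pmod p (isT : (0 < 4)%N).
have : odd (p %% 4) by rewrite odd_mod.
rewrite /chi4; case: (p %% 4)%N => [|[|[|[|//]]]] //= _ _; last first.
  have -> : (1 + (4 * 0 * x + 4 * x ^+ 2)) * ((1 - x) * (1 - (0 - 1) * x)) =
    1 + x ^+ 2 * (3 - 4 * x ^+ 2) by ring.
  by rewrite lerDl mulr_ge0 ?sqr_ge0 //; nra.
rewrite subr0; have : 1 <= 1 + x - 2 * x ^+ 2 by nra.
set y := _ - _ => y1.
have -> : (1 + (4 * 1 * x + 4 * x ^+ 2)) * ((1 - x) * (1 - 1 * x)) = y ^+ 2 by rewrite /y; ring.
by rewrite exprn_ege1.
Qed.

Lemma sum_chi4_divisor_sum_le (N : nat) :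
  \sum_(n < N.+1 | (0 < n)%N) chi4_divisor_sum R n / n%:R <=
  expR (4 * \sum_(p < N.+1 | prime_1mod4 p) p%:R^-1 + 4).
Proof.
pose ps := [seq p <- index_iota 0 N.+1 | prime p].
have gM p k m : prime p -> (0 < m)%N -> ~~ (p %| m)%N ->
    chi4_divisor_sum R (p ^ k * m) / (p ^ k * m)%:R =
    (\sum_(i < k.+1) chi4 R p ^+ i) / (p ^ k)%:R * (chi4_divisor_sum R m / m%:R).
  by move=> pp m0 pm; rewrite chi4_divisor_sum_pfactor // natrM invfM mulrACA.
have := @euler_sum_le R (fun n => chi4_divisor_sum R n / n%:R)
  (fun p k => (\sum_(i < k.+1) chi4 R p ^+ i) / (p ^ k)%:R) _ _ _ gM ps N.
have -> : \sum_(n < N.+1 | (0 < n)%N && all (mem ps) (primes n)) chi4_divisor_sum R n / n%:R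
  = \sum_(n < N.+1 | (0 < n)%N) chi4_divisor_sum R n / n%:R.
  apply: eq_bigl => n; case: (posnP n) => //= n0; apply/allP => p.
  rewrite mem_primes n0 /= mem_filter mem_index_iota /= => /andP[-> /dvdn_leq].
  by move=> /(_ n0) pn; rewrite (leq_ltn_trans pn).
move=> h; apply: le_trans (h _ _ _ _) _.
- by move=> n; rewrite mulr_ge0 ?chi4_divisor_sum_ge0 ?invr_ge0.
- by move=> p k; rewrite mulr_ge0 ?sum_chi4_ge0 ?invr_ge0.
- by rewrite /chi4_divisor_sum /divisors /= big_cons big_nil /chi4 /=; lra.
- by apply/allP => p; rewrite mem_filter => /andP[].
apply: (@le_trans _ _ (\prod_(p <- ps) expR (4 * (prime_1mod4 p)%:R / p%:R + 4 / p%:R ^+ 2))).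
  rewrite big_seq [leRHS]big_seq; apply: ler_prod => p; rewrite mem_filter => /andP[pp _].
  rewrite euler_factor_le_exp // andbT; apply: sumr_ge0 => k _.
  by rewrite mulr_ge0 ?sum_chi4_ge0 ?invr_ge0.
rewrite -expR_sum ler_expR big_split /= lerD //.
  rewrite big_filter big_mkord mulr_sumr big_mkcond [leRHS]big_mkcond /=.
  apply: ler_sum => p _; rewrite /prime_1mod4; case: (prime p) => //=.
  by case: (_ == _); rewrite ?mulr1 // mulr0 mul0r.
rewrite big_filter -mulr_sumr -[leRHS]mulr1 ler_wpM2l //.
case: N {h} @ps => [|N] ps; first by rewrite big_mkord big_mkcond big_ord_recl big_ord0 /= addr0 ler01.
rewrite big_mkcond big_nat_recl // big_nat_recl //= !add0r.
apply: (@le_trans _ _ (\sum_(1 <= n < N.+1) (n.+1%:R ^+ 2)^-1)).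
  rewrite [leRHS]big_add1 /=; apply: ler_sum => i _; by case: ifP => // _; rewrite invr_ge0 exprn_ge0.
apply: le_trans (@sum_inv_sqr_le R 1 N.+1 isT isT) _.
by rewrite invr1 lerBlDr lerDl invr_ge0.
Qed.

(** Otherwise the upper bound by the Euler product would be uniform in N, while
    the lower bound is a multiple of the harmonic series. *)
Lemma prime_1mod4_diverges (B : R) :
  exists z : nat, B <= \sum_(p < z.+1 | prime_1mod4 p) p%:R^-1.
Proof.
apply: contrapT => /forallNP nB.
apply: (@dvg_harmonic R); apply: nondecreasing_is_cvgn.
  apply/nondecreasing_seqP => n; rewrite !seriesEnat /= big_nat_recr //= lerDl.
  exact: harmonic_ge0.
exists (3 / 2 * expR (4 * B + 4)) => _ [n _ <-].
rewrite -ler_pdivrMl ?divr_gt0 // invf_div seriesEnat /= big_mkord.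
have -> : \sum_(i < n) harmonic i = \sum_(b < n.+1) b%:R^-1 :> R.
  by rewrite big_ord_recl invr0 add0r.
apply: le_trans (sum_chi4_divisor_sum_ge _ _) _.
apply: le_trans (sum_chi4_divisor_sum_le _) _.
rewrite ler_expR lerD2r ler_pM2l // ltW //.
by have /negP := nB n; rewrite -ltNge.
Qed.
End divergence.

(** * Second moment of residue class counts *)

Lemma sum_mod_eq (N M a : nat) : (a < M)%N ->
  (\sum_(0 <= m < N) (m %% M == a) = N %/ M + (a < N %% M))%N.
Proof.
move=> aM; have M0 : (0 < M)%N by apply: leq_ltn_trans aM.
elim: N => [|N IH]; first by rewrite big_geq // div0n mod0n.
rewrite big_nat_recr //= IH divnS // modnS.
have rM := ltn_pmod N M0.
case: ifP => dN; last by rewrite add0n; lia.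
have rE : (N %% M).+1 = M.
  by apply/eqP; rewrite eqn_leq rM dvdn_leq //= -addn1 /dvdn modnDml addn1.
by rewrite ltn0 addn0; lia.
Qed.

(** Consecutive blocks of length M contain exactly one member of each class. *)
Lemma class_count (R : realFieldType) (N M a : nat) : (0 < M)%N ->
  `|\sum_(1 <= m < N.+1) (m == a %[mod M])%N%:R - N%:R / M%:R| <= 1 :> R.
Proof.
move=> M0; pose b := ((a + M.-1) %% M)%N.
have -> : \sum_(1 <= m < N.+1) (m == a %[mod M])%N%:R =
    (\sum_(0 <= m < N) (m %% M == b))%N%:R :> R.
  rewrite big_add1 natr_sum /=; apply: eq_bigr => m _; congr (_ %:R).
  rewrite -(eqn_modDr M.-1) addSn -addnS prednK // modnDr.
  by rewrite eq_sym /b.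
rewrite sum_mod_eq ?ltn_pmod //.
have MR : 0 < M%:R :> R by rewrite ltr0n.
have -> : N%:R = (N %/ M)%:R * M%:R + (N %% M)%:R :> R by rewrite -natrM -natrD -divn_eq.
rewrite natrD mulrDl mulfK ?lt0r_neq0 //.
have := ltn_pmod N M0; set r := (N %% M)%N => rM.
have r0 : 0 <= r%:R / M%:R :> R by rewrite divr_ge0.
have r1 : r%:R / M%:R <= 1 :> R by rewrite ler_pdivrMr // mul1r ler_nat ltnW.
by rewrite ler_norml; case: (b < r)%N => /=; apply/andP; split; lra.
Qed.

(** The covariance of two residue classes.  For coprime moduli the intersection is one class modulo p * q, so
    that the main terms cancel and each of the three counts leaves a rounding
    error of at most 1; for equal moduli the trivial bound is enough. *)
Lemma class_pair_sum_le (R : realFieldType) (N p q a b : nat) :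
  (0 < p)%N -> (0 < q)%N -> (p = q \/ coprime p q) ->
  \sum_(1 <= m < N.+1) ((m == a %[mod p])%N%:R - p%:R^-1) *
                       ((m == b %[mod q])%N%:R - q%:R^-1)
  <= 3 + (p == q)%:R * (2 * N%:R / p%:R) :> R.
Proof.
move=> p0 q0 pq.
have inv01 (k : nat) : 0 <= (k%:R^-1 : R) <= 1.
  rewrite invr_ge0 ler0n /=; case: k => [|k]; first by rewrite invr0.
  by rewrite invf_le1 ?ltr0n // ler1n.
have /andP[x0 x1] := inv01 p; have /andP[y0 y1] := inv01 q.
pose C M c : R := \sum_(1 <= m < N.+1) (m == c %[mod M])%N%:R.
have CE M c : (0 < M)%N -> N%:R / M%:R - 1 <= C M c <= N%:R / M%:R + 1.
  move=> M0; have := class_count R N c M0; rewrite -/(C M c) ler_norml => /andP[h1 h2].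
  by apply/andP; split; lra.
have N0 : 0 <= N%:R :> R by [].
have Sx : \sum_(1 <= m < N.+1) p%:R^-1 * q%:R^-1 = N%:R * (p%:R^-1 * q%:R^-1) :> R.
  by rewrite sumr_const_nat subn1 mulr_natl.
have [Epq|npq] := eqVneq p q.
  rewrite -{q}Epq in q0 pq y0 y1 Sx *.
  apply: (@le_trans _ _ (\sum_(1 <= m < N.+1) ((m == a %[mod p])%N%:R + p%:R^-1 * p%:R^-1))).
    apply: ler_sum => m _.
    by case: (_ == _); case: (m == b %[mod p])%N => /=; nra.
  rewrite big_split /= Sx -/(C p a).
  have /andP[_ h] := CE p a p0.
  have : N%:R * (p%:R^-1 * p%:R^-1) <= N%:R / p%:R :> R.
    by rewrite ler_wpM2l // ler_piMl.
  by rewrite mul1r; lra.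
case: pq => [|cpq]; first by move/eqP: npq.
rewrite mul0r addr0.
(* C M c counts the class of c modulo M; the product of two indicators is the
   indicator of the class given by the Chinese remainder theorem. *)
have -> : \sum_(1 <= m < N.+1) ((m == a %[mod p])%N%:R - p%:R^-1) *
                       ((m == b %[mod q])%N%:R - q%:R^-1) =
   C (p * q)%N (chinese p q a b) - C p a / q%:R - C q b / p%:R + N%:R * (p%:R^-1 * q%:R^-1).
  rewrite -Sx /C !mulr_suml -!sumrB -big_split /=; apply: eq_bigr => m _.
  rewrite chinese_remainder // chinese_modl // chinese_modr //.
  by case: (m == a %[mod p])%N; case: (m == b %[mod q])%N => /=; ring.
have /andP[_ h1] := CE (p * q)%N (chinese p q a b) (ltac:(by rewrite muln_gt0 p0)).
have /andP[h2 _] := CE p a p0; have /andP[h3 _] := CE q b q0.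
have h2' := ler_wpM2r y0 h2; have h3' := ler_wpM2r x0 h3.
move: h1; rewrite natrM invfM => h1.
rewrite mulrBl mul1r -mulrA in h2'.
rewrite mulrBl mul1r -mulrA (mulrC q%:R^-1) in h3'.
lra.
Qed.

Lemma class_variance_le (R : realFieldType) (J : finType) (P : pred J)
    (q a : J -> nat) (N : nat) :
  (forall j, P j -> (0 < q j)%N) ->
  (forall j k, P j -> P k -> q j = q k \/ coprime (q j) (q k)) ->
  \sum_(1 <= m < N.+1)
     (\sum_(j | P j) ((m == a j %[mod q j])%N%:R - (q j)%:R^-1)) ^+ 2
  <= \sum_(j | P j) \sum_(k | P k)
       (3 + (q j == q k)%:R * (2 * N%:R / (q j)%:R)) :> R.
Proof.
move=> q0 qq.
under eq_bigr do rewrite expr2 mulr_suml.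
rewrite exchange_big /=; apply: ler_sum => j Pj.
under eq_bigr do rewrite mulr_sumr.
rewrite exchange_big /=; apply: ler_sum => k Pk.
apply: class_pair_sum_le; [exact: q0|exact: q0|exact: qq].
Qed.

(** * Sums of two squares modulo a prime *)

(** Wilson's theorem is the case k = 0.  Passing from k to k.+1 moves the factor
    p.-1 - k, which is - k.+1 modulo p, to the other factorial and costs one
    sign. *)
Lemma wilson_split p k : prime p -> (k < p)%N ->
  (k`! * (p.-1 - k)`!)%:R = (-1) ^+ k.+1 :> 'F_p.
Proof.
move=> pp; have p1 := prime_gt1 pp; have pch := pchar_Fp pp.
elim: k => [_|k IH kp].
  rewrite fact0 mul1n subn0 expr1; apply/eqP; rewrite -addr_eq0 natr1.
  by rewrite -(dvdn_pcharf pch) -Wilson.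
have /IH {}IH : (k < p)%N by apply: ltnW.
have Ej : (p.-1 - k)%N = (p.-1 - k.+1).+1 by lia.
rewrite exprS -IH Ej !factS !natrM.
have -> : (p.-1 - k.+1).+1%:R = - k.+1%:R :> 'F_p.
  apply/eqP; rewrite -addr_eq0 -natrD (_ : _ + _ = p)%N ?pchar_Fp_0 //; lia.
ring.
Qed.

(** In [wilson_split] with k = (p - 1) / 2 both factorials agree, and the sign
    is - 1 because (p - 1) / 2 is even.  So the factorial of (p - 1) / 2 is a
    root. *)
Lemma has_sqrtN1 p : prime_1mod4 p ->
  has (fun i => p %| i ^ 2 + 1)%N (iota 0 p).
Proof.
move=> /andP[pp /eqP p4]; have p1 := prime_gt1 pp; have pch := pchar_Fp pp.
pose h := (p %/ 4).*2.
have Ep : p = h.*2.+1 by rewrite {1}(divn_eq p 4) p4 /h; lia.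
have := @wilson_split p h pp (ltac:(by rewrite Ep; lia)).
rewrite (_ : p.-1 - h = h)%N; last by rewrite Ep; lia.
have -> : (-1) ^+ h.+1 = -1 :> 'F_p by rewrite -signr_odd /= /h odd_double expr1.
move=> /eqP; rewrite -addr_eq0 natr1 -(dvdn_pcharf pch) => H.
apply/hasP; exists (h`! %% p)%N; first by rewrite mem_iota ltn_pmod // ltnW.
by rewrite /dvdn -modnDml modnXm modnDml -mulnn addn1.
Qed.

Definition sqrtN1 (p : nat) : nat := find (fun i => p %| i ^ 2 + 1)%N (iota 0 p).

Lemma sqrtN1P p : prime_1mod4 p ->
  (sqrtN1 p < p)%N /\ (p %| sqrtN1 p ^ 2 + 1)%N.
Proof.
move=> p4; have h := has_sqrtN1 p4.
have lt : (sqrtN1 p < p)%N by rewrite -[X in (_ < X)%N](size_iota 0) -has_find.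
by split=> //; have := nth_find 0%N h; rewrite nth_iota.
Qed.

(** The lines m = i n and m = - i n modulo p, with i = sqrtN1 p, as residue classes of m. *)
Definition sqrtN1_class (p n : nat) (s : bool) : nat :=
  ((if s then sqrtN1 p else p - sqrtN1 p) * n)%N.

Definition on_line (p m n : nat) (s : bool) : bool :=
  (m == sqrtN1_class p n s %[mod p])%N.

(** If r + r' = p and r ^ 2 = -1 modulo p, then (m + r n) (m + r' n) is congruent
    to m ^ 2 + n ^ 2 modulo p. *)
Lemma on_lines_dvd p m n : prime_1mod4 p ->
  (p %| m ^ 2 + n ^ 2)%N = on_line p m n true || on_line p m n false.
Proof.
move=> p4; have [rp rN] := sqrtN1P p4; have /andP[pp _] := p4.
rewrite /on_line /sqrtN1_class; set r := sqrtN1 p in rp rN *; set r' := (p - r)%N.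
have Ep : (r + r')%N = p by rewrite subnKC // ltnW.
have E : ((m + r * n) * (m + r' * n) + (r ^ 2 + 1) * n ^ 2 =
    (m ^ 2 + n ^ 2) + p * (m * n + r * n ^ 2))%N by rewrite -Ep; ring.
rewrite -(dvdn_addl _ (dvdn_mulr (m * n + r * n ^ 2)%N (dvdnn p))) -E.
rewrite (dvdn_addl _ (dvdn_mulr (n ^ 2) rN)) Euclid_dvdM // orbC.
have cls a b : (a + b)%N = p -> (p %| m + a * n)%N = (m == b * n %[mod p])%N.
  move=> ab; rewrite -(eqn_modDr (a * n)) -mulnDl (addnC b) ab /dvdn.
  by rewrite -[X in _ = (_ == X)%N]/((p * n) %% p)%N modnMr.
by rewrite (cls r r') // (cls r' r) // addnC.
Qed.

(** Adding the two congruences gives 2 m = 0 modulo p, so p divides m and n. *)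
Lemma on_lines_both p m n : prime_1mod4 p ->
  on_line p m n true -> on_line p m n false -> (p ^ 2 %| m ^ 2 + n ^ 2)%N.
Proof.
move=> p4 h1 h2; have [rp rN] := sqrtN1P p4; have /andP[pp /eqP p1] := p4.
have op : odd p by have := divn_eq p 4; rewrite p1; lia.
have pD : (p %| m ^ 2 + n ^ 2)%N by rewrite on_lines_dvd // h1.
have pm : (p %| m)%N.
  have : (m + m == p * n %[mod p])%N.
    rewrite -modnDm {1}(eqP h1) (eqP h2) modnDm /sqrtN1_class -mulnDl subnKC //.
    exact: ltnW.
  rewrite modnMr addnn -mul2n => h; have : (p %| 2 * m)%N by [].
  by rewrite Gauss_dvdr // coprimen2.
have pn : (p %| n)%N.
  by move: pD; rewrite (dvdn_addr _ (dvdn_exp (isT : 0 < 2)%N pm)) Euclid_dvdX // andbT.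
by rewrite dvdn_add // dvdn_exp2r.
Qed.

(** Otherwise m ^ 2 = - n ^ 2 with n invertible; the odd power (p - 1) / 2 of
    this equation reads 1 = - 1 by Fermat's little theorem. *)
Lemma dvd_sum_sqr_3mod4 p m n : prime p -> (p %% 4 = 3)%N ->
  (p %| m ^ 2 + n ^ 2)%N -> (p ^ 2 %| m ^ 2 + n ^ 2)%N.
Proof.
move=> pp p3 pD; have pch := pchar_Fp pp.
pose k := (p %/ 4)%N.
have Ep : p = (2 * (2 * k + 1)).+1 by rewrite {1}(divn_eq p 4) p3 /k; lia.
have fermat a : (a%:R : 'F_p) ^+ p = a%:R.
  rewrite -natrX; apply/eqP; rewrite -(Fp_nat_mod pp) -[eqbRHS](Fp_nat_mod pp).
  by rewrite fermat_little.
have E : (m%:R : 'F_p) ^+ 2 = - (n%:R) ^+ 2.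
  by apply/eqP; rewrite -addr_eq0 -!natrX -natrD -(dvdn_pcharf pch).
have F : (m%:R : 'F_p) ^+ p.-1 = - (n%:R) ^+ p.-1.
  have -> : p.-1 = (2 * (2 * k + 1))%N by lia.
  rewrite !exprM E -[X in X ^+ _]mulN1r exprMn -signr_odd.
  by rewrite oddD oddM /= expr1 mulN1r.
have n0 : (n%:R : 'F_p) = 0.
  apply/eqP/negPn/negP => n0.
  have m0 : (m%:R : 'F_p) != 0 by have := expf_eq0 (m%:R : 'F_p) 2; rewrite E oppr_eq0 expf_eq0 /= => <-.
  have one a : (a%:R : 'F_p) != 0 -> (a%:R : 'F_p) ^+ p.-1 = 1.
    move=> a0; apply: (mulfI a0); rewrite -exprS prednK ?prime_gt0 // mulr1.
    exact: fermat.
  move: F; rewrite !one // => /eqP; rewrite -addr_eq0 -[_ + _]/(2%:R) -(dvdn_pcharf pch).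
  by move=> /dvdn_leq -/(_ isT); rewrite Ep; lia.
have pn : (p %| n)%N by rewrite (dvdn_pcharf pch) n0.
have pm : (p %| m)%N.
  by move: pD; rewrite (dvdn_addl _ (dvdn_exp (isT : 0 < 2)%N pn)) Euclid_dvdX // andbT.
by rewrite dvdn_add // dvdn_exp2r.
Qed.

(** * Sums of two squares divisible by prime powers *)

Lemma two_classes_count (R : realFieldType) (S : pred nat) (q N : nat) :
  (0 < q)%N ->
  (forall m m0, S m -> S m0 -> (m == m0 %[mod q])%N || (q %| m + m0)%N) ->
  \sum_(1 <= m < N.+1) (S m)%:R <= 2 * (N%:R / q%:R + 1) :> R.
Proof.
move=> q0 Sq.
have bound c : \sum_(1 <= m < N.+1) (m == c %[mod q])%N%:R <= N%:R / q%:R + 1 :> R.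
  by have := class_count R N c q0; rewrite ler_norml => /andP[_]; rewrite lerBlDl addrC.
have [/hasP[m0 _ Sm0]|/hasPn noS] := boolP (has S (index_iota 1 N.+1)); last first.
  rewrite big_seq big1 ?mulr_ge0 ?addr_ge0 ?divr_ge0 // => m /noS /negbTE ->//.
rewrite mulr2n mulrDl mul1r; apply: le_trans (lerD (bound m0) (bound (q.-1 * m0)%N)).
rewrite -big_split /=; apply: ler_sum => m _; rewrite -natrD ler_nat.
(* The class of - m0 is represented by q.-1 * m0. *)
have -> : (m == q.-1 * m0 %[mod q])%N = (q %| m + m0)%N.
  rewrite -(eqn_modDr m0) -{3}(mul1n m0) -mulnDl addn1 prednK //.
  by rewrite modnMr.
have [/Sq/(_ Sm0)|//] := boolP (S m).
by case: (_ == _); case: (q %| _)%N.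
Qed.

Lemma dvdn_sub_sqr (d m m0 n : nat) : (m0 <= m)%N ->
  (d %| m ^ 2 + n ^ 2)%N -> (d %| m0 ^ 2 + n ^ 2)%N -> (d %| (m - m0) * (m + m0))%N.
Proof.
move=> le h h0; rewrite -subn_sqr.
by have := dvdn_sub h h0; rewrite subnDr.
Qed.

(** If p ^ (2 K) divides (m - m0) (m + m0), then p ^ K divides one of the two
    factors, so m lies in one of two classes.  The bound is weak but uniform in n, and it is small for
    large K. *)
Lemma count_pfactor_sum_sqr (R : realFieldType) (p K N n : nat) : prime p ->
  \sum_(1 <= m < N.+1) (p ^ K.*2 %| m ^ 2 + n ^ 2)%N%:R
    <= 2 * (N%:R / (p ^ K)%:R + 1) :> R.
Proof.
move=> pp; have p0 := prime_gt0 pp.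
apply: (@two_classes_count R (fun m => p ^ K.*2 %| m ^ 2 + n ^ 2)%N).
  by rewrite expn_gt0 p0.
suff main m m0 : (m0 <= m)%N -> (p ^ K.*2 %| m ^ 2 + n ^ 2)%N ->
    (p ^ K.*2 %| m0 ^ 2 + n ^ 2)%N -> (m == m0 %[mod p ^ K])%N || (p ^ K %| m + m0)%N.
  move=> m m0 h h0; case: (leqP m0 m) => le; first exact: main.
  by rewrite eq_sym addnC; apply: main => //; exact: ltnW.
rewrite leq_eqVlt => /orP[/eqP -> //|lt h h0]; first by rewrite eqxx.
have := dvdn_sub_sqr (ltnW lt) h h0.
rewrite eqn_mod_dvd ?(ltnW lt) //.
have s0 : (0 < m - m0)%N by rewrite subn_gt0.
have a0 : (0 < m + m0)%N by rewrite addn_gt0 (leq_ltn_trans _ lt).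
rewrite !pfactor_dvdn ?muln_gt0 ?s0 // lognM //; lia.
Qed.

(** Here p cannot divide both m - m0 and m + m0, so p ^ 2 divides one of them. *)
Lemma count_sqr_dvd_coprime (R : realFieldType) (p N n : nat) :
  prime p -> odd p -> ~~ (p %| n)%N ->
  \sum_(1 <= m < N.+1) (p ^ 2 %| m ^ 2 + n ^ 2)%N%:R
    <= 2 * (N%:R / p%:R ^+ 2 + 1) :> R.
Proof.
move=> pp op pn; have p0 := prime_gt0 pp; rewrite -natrX.
apply: (@two_classes_count R (fun m => p ^ 2 %| m ^ 2 + n ^ 2)%N).
  by rewrite expn_gt0 p0.
suff main m m0 : (m0 <= m)%N -> (p ^ 2 %| m ^ 2 + n ^ 2)%N ->
    (p ^ 2 %| m0 ^ 2 + n ^ 2)%N -> (m == m0 %[mod p ^ 2])%N || (p ^ 2 %| m + m0)%N.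
  move=> m m0 h h0; case: (leqP m0 m) => le; first exact: main.
  by rewrite eq_sym addnC; apply: main => //; exact: ltnW.
move=> le h h0; have := dvdn_sub_sqr le h h0.
rewrite eqn_mod_dvd //.
have [ps|ps] := boolP (p %| m - m0)%N; last first.
  by rewrite Gauss_dvdr ?coprimeXl ?prime_coprime // => ->; rewrite orbT.
have pa : ~~ (p %| m + m0)%N.
  apply: contra pn => pa.
  have E : (2 * m = (m - m0) + (m + m0))%N by lia.
  have : (p %| 2 * m)%N by rewrite E dvdn_add.
  rewrite Gauss_dvdr ?coprimen2 // => pm.
  have : (p %| m ^ 2 + n ^ 2)%N by apply: dvdn_trans h; rewrite dvdn_exp.
  by rewrite (dvdn_addr _ (dvdn_exp (isT : 0 < 2)%N pm)) Euclid_dvdX // andbT.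
by rewrite Gauss_dvdl ?coprimeXl ?prime_coprime // => ->.
Qed.

(** If p divides n it also divides m, which leaves at most (N / p) ^ 2 pairs; the
    other n are covered by [count_sqr_dvd_coprime].  The main term is summable
    over p. *)
Lemma count_sqr_dvd_sum_sqr (R : realFieldType) (p N : nat) :
  prime p -> odd p ->
  \sum_(1 <= n < N.+1) \sum_(1 <= m < N.+1) (p ^ 2 %| m ^ 2 + n ^ 2)%N%:R
    <= 3 * N%:R ^+ 2 / p%:R ^+ 2 + 2 * N%:R :> R.
Proof.
move=> pp op; have p0 := prime_gt0 pp.
have cnt : \sum_(1 <= m < N.+1) (p %| m)%N%:R <= N%:R / p%:R :> R.
  rewrite -natr_sum -divn_count_dvd ler_pdivlMr ?ltr0n // -natrM ler_nat.
  exact: leq_divM.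
have c0 : 0 <= \sum_(1 <= m < N.+1) (p %| m)%N%:R :> R by apply: sumr_ge0.
apply: (@le_trans _ _ (\sum_(1 <= n < N.+1) (2 * (N%:R / p%:R ^+ 2 + 1) +
    (p %| n)%N%:R * \sum_(1 <= m < N.+1) (p %| m)%N%:R))).
  apply: ler_sum => n _; have [pn|pn] := boolP (p %| n)%N; last first.
    by rewrite mul0r addr0 count_sqr_dvd_coprime.
  rewrite mul1r -[leLHS]add0r lerD ?mulr_ge0 ?addr_ge0 ?divr_ge0 ?exprn_ge0 //.
  apply: ler_sum => m _; rewrite ler_nat.
  case: (boolP (p ^ 2 %| _)%N) => // h.
  have : (p %| m ^ 2 + n ^ 2)%N by apply: dvdn_trans h; rewrite dvdn_exp.
  by rewrite (dvdn_addl _ (dvdn_exp (isT : 0 < 2)%N pn)) Euclid_dvdX // andbT => ->.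
rewrite big_split /= sumr_const_nat subn1 -mulr_suml.
apply: (@le_trans _ _ (2 * (N%:R / p%:R ^+ 2 + 1) *+ N + N%:R / p%:R * (N%:R / p%:R))).
  by rewrite lerD2l ler_pM.
rewrite -mulr_natr le_eqVlt; apply/orP; left; apply/eqP; field.
by rewrite pnatr_eq0 -lt0n.
Qed.

(** If S is this sum, then z ^ S is at most the part of D composed of primes
    above z, hence at most D <= 2 * z ^ 8 <= z ^ 9. *)
Lemma sum_logn_large_le (z N D : nat) : (1 < z)%N -> N = (z ^ 4)%N ->
  (0 < D)%N -> (D <= 2 * N ^ 2)%N -> forall M, (D < M)%N -> (z < M)%N ->
  (\sum_(z.+1 <= p < M) logn p D <= 9)%N.
Proof.
move=> z1 EN D0 DN M DM zM.
rewrite -(leq_exp2l _ _ z1).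
apply: (@leq_trans D); last first.
  by apply: leq_trans DN _; rewrite EN -expnM [leqRHS](expnS z 8) leq_mul2r z1 orbT.
rewrite expn_sum.
have -> : (\prod_(z.+1 <= p < M) z ^ logn p D =
    \prod_(0 <= p < M | (z < p)%N) z ^ logn p D)%N.
  rewrite [RHS](big_cat_nat (n := z.+1)) //= [X in _ = (X * _)%N]big1_seq ?mul1n.
    by rewrite big_nat [RHS]big_nat_cond; apply: eq_bigl => p; case: (z < p)%N; rewrite /= ?andbT ?andbF.
  by move=> p /andP[zp]; rewrite mem_index_iota => /andP[_]; rewrite ltnNge zp.
case: M DM zM => // M DM zM.
apply: (@leq_trans (D`_[pred p | z < p]%N)%N); last exact: dvdn_leq (dvdn_part _ _).
rewrite (@widen_partn M _ D DM); apply: leq_prod => p zp.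
by case: (logn p D) => // k; rewrite leq_exp2r // ltnW.
Qed.

(** * Comparison of Omega with a sum over small primes *)

Lemma OmegaE (D M : nat) : (0 < D < M)%N ->
  Omega D = (\sum_(0 <= p < M) logn p D)%N.
Proof.
move=> /andP[D0 DM]; rewrite /Omega.
transitivity (\sum_(0 <= p < M | p \in primes D) logn p D)%N; last first.
  rewrite big_mkcond; apply: eq_bigr => p _.
  by rewrite -logn_gt0; case: (logn p D).
rewrite -[RHS]big_filter; apply: perm_big; apply: uniq_perm.
- exact: primes_uniq.
- by rewrite filter_uniq // iota_uniq.
move=> p; rewrite mem_filter mem_index_iota /=.
case: (boolP (p \in primes D)) => //=; rewrite mem_primes => /and3P[_ _ pD].
by rewrite (leq_ltn_trans (dvdn_leq D0 pD) DM).
Qed.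

Definition line_count (z m n : nat) : nat :=
  (\sum_(0 <= p < z.+1 | prime_1mod4 p) \sum_(s : bool) on_line p m n s)%N.

(** As p ^ 2 does not divide m ^ 2 + n ^ 2, the pair is not on both lines modulo
    p, and p is not 3 modulo 4 if it divides m ^ 2 + n ^ 2. *)
Lemma logn_on_lines p m n : prime p -> (2 < p)%N -> (0 < m)%N ->
  ~~ (p ^ 2 %| m ^ 2 + n ^ 2)%N ->
  logn p (m ^ 2 + n ^ 2) =
    (if prime_1mod4 p then \sum_(s : bool) on_line p m n s else 0)%N.
Proof.
move=> pp p2 m0 nsq; set D := (m ^ 2 + n ^ 2)%N in nsq *.
have D0 : (0 < D)%N by rewrite addn_gt0 expn_gt0 m0.
have -> : logn p D = (p %| D)%N.
  have : ~~ (2 <= logn p D)%N by rewrite -pfactor_dvdn.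
  have -> : (p %| D)%N = (0 < logn p D)%N by rewrite logn_gt0 mem_primes pp D0.
  by case: (logn p D) => [|[|]].
have op : odd p by case: (even_prime pp) p2 => // ->.
case: ifP => p4.
  rewrite big_bool /= on_lines_dvd //.
  have := @on_lines_both p m n p4; rewrite -/D.
  case: (on_line p m n true) => //; case: (on_line p m n false) => // /(_ isT isT).
  by rewrite (negbTE nsq).
case: (boolP (p %| D)%N) => // pD; case/negP: nsq; apply: dvd_sum_sqr_3mod4 => //.
move: p4; rewrite /prime_1mod4 pp /=; have := ltn_pmod p (isT : (0 < 4)%N).
by have : odd (p %% 4) by [rewrite odd_mod]; case: (p %% 4)%N => [|[|[|[|]]]].
Qed.

(** The primes in (Y, z] contribute the same to both sides, those up to Y a
    bounded amount, and those above z at most 9 to Omega. *)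
Lemma Omega_line_count (z N Y K m n : nat) :
  (1 < z)%N -> N = (z ^ 4)%N -> (1 < Y <= z)%N -> (0 < m <= N)%N -> (n <= N)%N ->
  (forall p, prime p -> (Y < p <= z)%N -> ~~ (p ^ 2 %| m ^ 2 + n ^ 2)%N) ->
  (forall p, prime p -> (p <= Y)%N -> ~~ (p ^ K.*2 %| m ^ 2 + n ^ 2)%N) ->
  (line_count z m n <= Omega (m ^ 2 + n ^ 2) + Y.+1 * 2)%N /\
  (Omega (m ^ 2 + n ^ 2) <= line_count z m n + (Y.+1 * K.*2 + 9))%N.
Proof.
move=> z1 EN /andP[Y1 Yz] /andP[m0 mN] nN sqf pwf; set D := (m ^ 2 + n ^ 2)%N.
have D0 : (0 < D)%N by rewrite addn_gt0 expn_gt0 m0.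
have DN : (D <= 2 * N ^ 2)%N.
  by rewrite mul2n -addnn leq_add // leq_exp2r.
pose M := (D + z).+1.
have DM : (0 < D < M)%N by rewrite D0 ltnS leq_addr.
have mid : (\sum_(Y.+1 <= p < z.+1) logn p D =
    \sum_(Y.+1 <= p < z.+1 | prime_1mod4 p) \sum_(s : bool) on_line p m n s)%N.
  rewrite [RHS]big_mkcond; apply: eq_big_nat => p /andP[Yp pz].
  have [pp|np] := boolP (prime p); last first.
    by rewrite /prime_1mod4 (negbTE np) lognE (negbTE np).
  by apply: logn_on_lines; rewrite ?(leq_ltn_trans Y1) //; apply: sqf; rewrite ?Yp.
have big := @sum_logn_large_le z N D z1 EN D0 DN M (ltac:(by case/andP: DM))
  (ltac:(by rewrite ltnS leq_addl)).
rewrite (OmegaE DM) (big_cat_nat (n := z.+1)) //=; last by rewrite ltnS leq_addl.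
rewrite (big_cat_nat (m := 0) (n := Y.+1) (p := z.+1)) //= mid.
rewrite /line_count (big_cat_nat (n := Y.+1) (p := z.+1)) //=.
set S := (\sum_(Y.+1 <= p < z.+1 | _) _)%N.
split.
  apply: (@leq_trans (Y.+1 * 2 + S)%N); last by lia.
  rewrite leq_add2r big_mkcond.
  apply: (@leq_trans (\sum_(0 <= p < Y.+1) 2)%N); last by rewrite sum_nat_const_nat subn0.
  apply: leq_sum => p _; case: ifP => // _; rewrite big_bool.
  by case: on_line; case: on_line.
have small : (\sum_(0 <= p < Y.+1) logn p D <= Y.+1 * K.*2)%N.
  apply: (@leq_trans (\sum_(0 <= p < Y.+1) K.*2)%N); last by rewrite sum_nat_const_nat subn0.
  rewrite big_nat_cond [leqRHS]big_nat_cond; apply: leq_sum => p /andP[/andP[_ pY] _].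
  have [pp|np] := boolP (prime p); last by rewrite lognE (negbTE np).
  by rewrite leqNgt; apply: contra (pwf p pp pY) => /ltnW; rewrite pfactor_dvdn.
lia.
Qed.

Section normal_order.
Context {R : realFieldType}.

(** The mean of [line_count]: each of the two lines modulo p has density 1 / p. *)
Definition mean_lines (z : nat) : R := 2 * \sum_(p < z.+1 | prime_1mod4 p) p%:R^-1.

Lemma mean_linesS z : mean_lines z <= mean_lines z.+1 <= mean_lines z + 1.
Proof.
rewrite /mean_lines [\sum_(_ < z.+2 | _) _]big_mkcond big_ord_recr /= -big_mkcond /=.
case: ifP => [/andP[pp _]|_]; last by lra.
have p1 : 2 <= z.+1%:R :> R by rewrite ler_nat prime_gt1.
have h : z.+1%:R^-1 <= 2^-1 :> R by rewrite lef_pV2 ?posrE // (lt_le_trans _ p1).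
have h0 : 0 <= z.+1%:R^-1 :> R by rewrite invr_ge0.
move: h h0; move: (z.+1%:R^-1) => v h h0.
by rewrite mulrDr lerDl lerD2l mulr_ge0 //=; lra.
Qed.

Lemma mean_lines_ge0 z : 0 <= mean_lines z.
Proof. by rewrite mulr_ge0 // sumr_ge0 // => p _; rewrite invr_ge0. Qed.

(** [class_variance_le] for the lines modulo all p <= z.  There are at most
    2 * z.+1 <= 4 * z lines, and two of them share each modulus. *)
Lemma line_count_variance z N n : (0 < z)%N ->
  \sum_(1 <= m < N.+1) ((line_count z m n)%:R - mean_lines z) ^+ 2
    <= 48 * z%:R ^+ 2 + 4 * N%:R * mean_lines z.
Proof.
move=> z0.
pose J := ('I_z.+1 * bool)%type.
pose P (j : J) := prime_1mod4 j.1.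
have prP (j : J) : P j -> prime j.1 by case/andP.
have := @class_variance_le R J P (fun j => j.1) (fun j => sqrtN1_class j.1 n j.2) N.
have sumJ (F : nat -> bool -> R) :
    \sum_(j | P j) F j.1 j.2 = \sum_(p < z.+1 | prime_1mod4 p) \sum_(s : bool) F p s.
  by rewrite pair_big; apply: eq_bigl => j; rewrite andbT.
have -> : \sum_(1 <= m < N.+1) (\sum_(j | P j)
    ((m == sqrtN1_class j.1 n j.2 %[mod j.1])%N%:R - (j.1%:R)^-1)) ^+ 2 =
  \sum_(1 <= m < N.+1) ((line_count z m n)%:R - mean_lines z) ^+ 2.
  apply: eq_bigr => m _; congr (_ ^+ 2).
  rewrite sumrB; congr (_ - _).
    rewrite (sumJ (fun p s => (on_line p m n s)%:R)) /line_count natr_sum big_mkord.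
    by apply: eq_bigr => p _; rewrite natr_sum.
  rewrite (sumJ (fun p _ => p%:R^-1)) /mean_lines mulr_sumr; apply: eq_bigr => p _.
  by rewrite big_bool mulr2n mulrDl mul1r.
move=> /(_ (fun j Pj => prime_gt0 (prP j Pj))) /= h.
apply: le_trans (h _) _.
  move=> j k /prP pj /prP pk; have [->|ne] := eqVneq (j.1 : nat) k.1; first by left.
  by right; rewrite prime_coprime // dvdn_prime2.
have cardJ : \sum_(j | P j) (1 : R) <= 4 * z%:R.
  apply: (@le_trans _ _ (\sum_(j : J) (1 : R))).
    by rewrite big_mkcond; apply: ler_sum => j _; case: ifP.
  rewrite sumr_const card_prod card_ord card_bool -natrM ler_nat; lia.
have cardJ0 : 0 <= \sum_(j | P j) (1 : R) by apply: sumr_ge0.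
have diag (j : J) : \sum_(k | P k) (j.1 == k.1 :> nat)%:R <= 2 :> R.
  rewrite (sumJ (fun k _ => (j.1 == k :> nat)%:R)).
  apply: (@le_trans _ _ (\sum_(p < z.+1) 2 * (j.1 == p)%:R)).
    rewrite big_mkcond; apply: ler_sum => p _; rewrite big_bool -val_eqE /=.
    by case: ifP; case: eqP => _ _ /=; lra.
  rewrite (bigD1 j.1) //= eqxx big1 ?addr0 ?mulr1 // => p /negbTE.
  by rewrite eq_sym => ->; rewrite mulr0.
apply: (@le_trans _ _ (\sum_(j | P j) (3 * \sum_(k | P k) (1 : R) +
    2 * (2 * N%:R / j.1%:R)))).
  apply: ler_sum => j Pj; rewrite big_split /= -mulr_suml lerD //.
    by rewrite mulr_sumr; apply: ler_sum => k _; rewrite mulr1.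
  by rewrite ler_wpM2r // mulr_ge0 ?invr_ge0 // mulr_ge0.
rewrite big_split /= lerD //.
  under eq_bigr do rewrite -[3 * _]mulr1.
  rewrite -mulr_sumr; nra.
rewrite (sumJ (fun p _ => 2 * (2 * N%:R / p%:R))) /mean_lines !mulr_sumr.
by apply: ler_sum => p _; rewrite big_bool /=; lra.
Qed.
End normal_order.
Arguments mean_lines R z : clear implicits.

(** * Normal order of Omega on sums of two squares *)

Lemma exists_nat_ge (R : realType) (n0 : nat) (x : R) :
  exists n : nat, (n0 <= n)%N /\ x <= n%:R.
Proof.
exists (n0 + Num.bound `|x|)%N; split; first exact: leq_addr.
rewrite (le_trans (ler_norm x)) // (le_trans (ltW (archi_boundP (normr_ge0 x)))) //.
by rewrite ler_nat leq_addl.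
Qed.

(** Since mean_lines grows by steps of at most 1 and is unbounded, the first z at which
    it reaches t works. *)
Lemma exists_mean_lines (R : realType) (t : nat) : (0 < t)%N ->
  exists z, (t <= z)%N /\ (t%:R : R) <= mean_lines R z <= t%:R + 1.
Proof.
move=> t0; have [z1 hz1] := @prime_1mod4_diverges R t%:R.
have ex : exists z, t%:R <= mean_lines R z :> R.
  exists z1; apply: le_trans hz1 _; rewrite /mean_lines ler_peMl ?ler1n //.
  by rewrite sumr_ge0 // => p _; rewrite invr_ge0.
have m0 : mean_lines R 0 = 0 :> R.
  by rewrite /mean_lines big_mkcond big_ord_recl big_ord0 /= addr0 mulr0.
have mz z : mean_lines R z <= z%:R :> R.
  elim: z => [|z IH]; first by rewrite m0.
  by have /andP[_ /le_trans] := @mean_linesS R z; apply; rewrite -natr1 lerD2r.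
have tz z : t%:R <= mean_lines R z :> R -> (t <= z)%N.
  by move=> h; rewrite -(ler_nat R); apply: le_trans h _.
case: (ex_minnP ex) => z hz min; exists z; split; first exact: tz.
rewrite hz /=; case: z hz min => [|z] hz min; first by have := tz _ hz; lia.
have /andP[_ /le_trans] := @mean_linesS R z; apply; rewrite lerD2r leNgt.
by apply/negP => /ltW/min; rewrite ltnn.
Qed.

(** Outside the exceptional divisibility conditions counted by the last two
    sums, a deviation of Omega by eta * t forces [line_count] to deviate from
    its mean by eta * t / 2, which the first term detects. *)
Lemma Omega_deviation_le (R : realType) (eta : R) (z N Y K t m n : nat) :
  (1 < z)%N -> N = (z ^ 4)%N -> (1 < Y <= z)%N -> (0 < m <= N)%N -> (n <= N)%N ->
  0 < eta -> (0 < t)%N ->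
  (t%:R : R) <= mean_lines R z <= t%:R + 1 ->
  (Y.+1 * 2 + Y.+1 * K.*2 + 10)%N%:R <= eta * t%:R / 2 ->
  (~~ (`|(Omega (m ^ 2 + n ^ 2))%:R - t%:R| <= eta * t%:R))%:R <=
  ((line_count z m n)%:R - mean_lines R z) ^+ 2 / (eta * t%:R / 2) ^+ 2
  + \sum_(Y.+1 <= p < z.+1 | prime p) (p ^ 2 %| m ^ 2 + n ^ 2)%N%:R
  + \sum_(0 <= p < Y.+1 | prime p) (p ^ K.*2 %| m ^ 2 + n ^ 2)%N%:R.
Proof.
move=> z1 EN YY mm nn eta0 t0 /andP[ct1 ct2] hk.
set k := eta * t%:R / 2 in hk *.
have k0 : 0 < k by rewrite !divr_gt0 ?mulr_gt0 ?ltr0n.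
set T1 := _ / _; set T2 := \sum_(_ <= p < z.+1 | _) _; set T3 := \sum_(0 <= p < _ | _) _.
have T1_ge0 : 0 <= T1 by rewrite divr_ge0 ?sqr_ge0.
have T2_ge0 : 0 <= T2 by apply: sumr_ge0.
have T3_ge0 : 0 <= T3 by apply: sumr_ge0.
case: (boolP (`|_| <= _)) => [_|bad]; first by have : 0 <= T1 + T2 + T3 by rewrite !addr_ge0.
change (1 <= T1 + T2 + T3).
have one (a b : nat) (Q : pred nat) : (exists2 p, prime p && Q p & (a <= p < b)%N) ->
    1 <= \sum_(a <= p < b | prime p) (Q p)%:R :> R.
  move=> [p /andP[pp Qp] pab]; rewrite big_mkcond /=.
  rewrite (bigD1_seq p) ?mem_index_iota ?iota_uniq //= pp Qp lerDl.
  by apply: sumr_ge0 => q _; case: ifP.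
have [/hasP[p]|/hasPn sqf] := boolP (has (fun p => prime p &&
    (p ^ 2 %| m ^ 2 + n ^ 2)%N) (index_iota Y.+1 z.+1)).
  rewrite mem_index_iota => pyz pQ.
  suff : 1 <= T2 by lra.
  by apply: (one _ _ (fun p => (p ^ 2 %| m ^ 2 + n ^ 2)%N)); exists p.
have [/hasP[p]|/hasPn pwf] := boolP (has (fun p => prime p &&
    (p ^ K.*2 %| m ^ 2 + n ^ 2)%N) (index_iota 0 Y.+1)).
  rewrite mem_index_iota => pyz pQ.
  suff : 1 <= T3 by lra.
  by apply: (one _ _ (fun p => (p ^ K.*2 %| m ^ 2 + n ^ 2)%N)); exists p.
suff : 1 <= T1 by rewrite /= => h1; lra.
have [h1 h2] := @Omega_line_count z N Y K m n z1 EN YY mm nn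
  (ltac:(by move=> p pp pyz; have := sqf p; rewrite mem_index_iota pp /= => -> //; rewrite ltnS))
  (ltac:(by move=> p pp pyz; have := pwf p; rewrite mem_index_iota pp /= => -> //; rewrite ltnS)).
move: (Y.+1 * 2)%N (Y.+1 * K.*2)%N h1 h2 hk => a b h1 h2.
move: h1 h2; rewrite -!(ler_nat R) !natrD => h1 h2 hk.
rewrite /T1 -expr_div_n -real_normK ?num_real // exprn_ege1 //.
rewrite normrM normfV (gtr0_norm k0) ler_pdivlMr // mul1r.
move: bad; rewrite ler_norml negb_and -!ltNge => bad.
have ek : eta * t%:R = 2 * k by rewrite /k; field.
have a0 : 0 <= a%:R :> R by []; have b0 : 0 <= b%:R :> R by [].
rewrite ek in bad.
rewrite ler_normr; case/orP: bad => bad; apply/orP; [right|left]; lra.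
Qed.

(** The three terms come from the tail of the sum of 3 / p ^ 2 over p > Y, from
    the rounding errors of at most z primes (as z ^ 2 <= N), and from the at
    most Y.+1 primes with a high power. *)
Lemma count_exceptional (R : realType) (z N Y K : nat) :
  (0 < z)%N -> N = (z ^ 4)%N -> (1 < Y <= z)%N ->
  \sum_(1 <= n < N.+1) \sum_(1 <= m < N.+1)
     (\sum_(Y.+1 <= p < z.+1 | prime p) (p ^ 2 %| m ^ 2 + n ^ 2)%N%:R
      + \sum_(0 <= p < Y.+1 | prime p) (p ^ K.*2 %| m ^ 2 + n ^ 2)%N%:R)
  <= N%:R ^+ 2 * (3 / Y%:R + 2 / z%:R + 2 * Y.+1%:R * ((2 ^ K)%:R^-1 + z%:R^-1)) :> R.
Proof.
move=> z0 EN /andP[Y1 Yz]; have Y0 : (0 < Y)%N by apply: ltnW.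
have zR : 0 < z%:R :> R by rewrite ltr0n.
have NzR : N%:R = z%:R ^+ 4 :> R by rewrite EN natrX.
have z1R : 1 <= z%:R :> R by rewrite ler1n.
under eq_bigr do rewrite big_split /=.
rewrite big_split /= mulrDr lerD //.
  under eq_bigr do rewrite exchange_big /=.
  rewrite exchange_big /=.
  apply: (@le_trans _ _ (\sum_(Y.+1 <= p < z.+1)
     (3 * N%:R ^+ 2 / p%:R ^+ 2 + 2 * N%:R))).
    rewrite big_nat_cond big_mkcond [leRHS]big_nat_cond [leRHS]big_mkcond.
    apply: ler_sum => p _; case: (boolP (_ && _)) => [/andP[Yp pp]|_] /=; last first.
      by case: ifP => // _; rewrite addr_ge0 ?mulr_ge0 ?exprn_ge0 ?invr_ge0 ?exprn_ge0.
    rewrite Yp; apply: count_sqr_dvd_sum_sqr => //.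
    by case: (even_prime pp) => // p2; move: Yp; rewrite p2; lia.
  rewrite big_split /= mulrDr lerD //.
    rewrite -mulr_sumr big_add1 /= mulrA (mulrC _ 3) ler_wpM2l ?mulr_ge0 ?sqr_ge0 //.
    by apply: le_trans (@sum_inv_sqr_le R Y z Y0 Yz) _; rewrite lerBlDr lerDl invr_ge0.
  rewrite sumr_const_nat subSS -[leLHS]mulr_natr.
  apply: (@le_trans _ _ (2 * N%:R * z%:R)).
    by rewrite ler_wpM2l ?mulr_ge0 // ler_nat leq_subr.
  rewrite mulrCA -mulrA ler_wpM2l // expr2 -mulrA ler_wpM2l //.
  rewrite ler_pdivlMr // NzR -expr2; exact: ler_weXn2l.
have N2 : N%:R <= N%:R ^+ 2 / z%:R :> R.
  by rewrite expr2 -mulrA ler_peMr // ler_pdivlMr // mul1r NzR ler_eXnr.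
under eq_bigr do rewrite exchange_big /=.
rewrite exchange_big /=.
apply: (@le_trans _ _ (\sum_(0 <= p < Y.+1)
     (2 * (N%:R / (2 ^ K)%:R + 1) *+ N))).
  rewrite big_mkcond; apply: ler_sum => p _; case: ifP => [pp|_]; last first.
    by rewrite mulrn_wge0 ?mulr_ge0 ?addr_ge0 ?divr_ge0.
  set b := 2 * _; rewrite (_ : b *+ N = \sum_(1 <= n < N.+1) b); last by rewrite sumr_const_nat subn1.
  apply: ler_sum => n _.
  apply: le_trans (@count_pfactor_sum_sqr R p K N n pp) _.
  rewrite ler_wpM2l // lerD2r ler_wpM2l // lef_pV2 ?posrE ?ltr0n ?expn_gt0 ?prime_gt0 //.
  by rewrite ler_nat; case: (K) => // k; rewrite leq_exp2r // prime_gt1.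
rewrite sumr_const_nat subn0 -[leLHS]mulr_natr -(mulr_natr (2 * _)).
set v := (2 ^ K)%:R^-1.
have -> : 2 * (N%:R * v + 1) * N%:R * Y.+1%:R =
  2 * Y.+1%:R * (N%:R ^+ 2 * v + N%:R) by ring.
by rewrite mulrCA ler_wpM2l // mulrDr lerD2l.
Qed.

(** The parameters are chosen in the order Y, K, t: the exceptional pairs of
    [count_exceptional] shrink with Y, then with K, and the variance term is of
    order 1 / (eta ^ 2 * t). *)
Lemma Omega_sum_sqr_normal_order (R : realType) (eta delta : R) :
  0 < eta -> 0 < delta ->
  exists t0 : nat, forall t, (t0 <= t)%N -> exists N, [/\ (t <= N)%N, (0 < N)%N &
   \sum_(1 <= m < N.+1) \sum_(1 <= n < N.+1)
     (~~ (`|(Omega (m ^ 2 + n ^ 2))%:R - t%:R| <= eta * t%:R))%:R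
   <= delta * N%:R ^+ 2].
Proof.
move=> eta0 delta0.
have [Y [Y1 hY]] := exists_nat_ge 2 (12 / delta).
have [K [_ hK]] := exists_nat_ge 0 (8 * Y.+1%:R / delta).
have [t1 [_ ht1]] := exists_nat_ge 0 (2 * (Y.+1 * 2 + Y.+1 * K.*2 + 10)%N%:R / eta).
have [t2 [_ ht2]] := exists_nat_ge 0 ((32 / eta ^+ 2 + 2 + 2 * Y.+1%:R) * 2 / delta).
(* The variance needs 52 + 4 * t <= 8 * t; t1 absorbs the bounded discrepancy
   between Omega and line_count, and t2 the terms of order 1 / t. *)
exists (13 + Y + t1 + t2)%N => t ht.
have [t13 Yt t1t t2t] : [/\ (13 <= t)%N, (Y <= t)%N, (t1 <= t)%N & (t2 <= t)%N].
  by clear -ht; split; lia.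
have t0 : (0 < t)%N by apply: leq_trans t13.
have tR : 0 < t%:R :> R by rewrite ltr0n.
have [z [tz cz]] := exists_mean_lines R t0.
exists (z ^ 4)%N; set N := (z ^ 4)%N.
have z1 : (1 < z)%N by apply: leq_trans tz; apply: leq_trans t13.
have z0 : (0 < z)%N by apply: ltnW.
have zN : (z <= N)%N by rewrite /N expnSr leq_pmull // expn_gt0 z0.
have N0 : (0 < N)%N by apply: leq_trans zN.
split; rewrite ?(leq_trans tz zN) //.
have YP : (1 < Y <= z)%N by rewrite Y1 (leq_trans Yt).
have hC : (Y.+1 * 2 + Y.+1 * K.*2 + 10)%N%:R <= eta * t%:R / 2.
  have : t1%:R <= t%:R :> R by rewrite ler_nat.
  by move/(le_trans ht1); rewrite ler_pdivrMr // ler_pdivlMr // mulrC (mulrC eta).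
rewrite exchange_big /=.
apply: (@le_trans _ _ (\sum_(1 <= n < N.+1) \sum_(1 <= m < N.+1)
 (((line_count z m n)%:R - mean_lines R z) ^+ 2 / (eta * t%:R / 2) ^+ 2 +
   (\sum_(Y.+1 <= p < z.+1 | prime p) (p ^ 2 %| m ^ 2 + n ^ 2)%N%:R
  + \sum_(0 <= p < Y.+1 | prime p) (p ^ K.*2 %| m ^ 2 + n ^ 2)%N%:R)))).
  apply: ler_sum_nat => n /andP[n1 nN]; apply: ler_sum_nat => m mN.
  rewrite addrA; apply: (@Omega_deviation_le R eta z N Y K t) => //.
under eq_bigr do rewrite big_split /= -mulr_suml.
rewrite big_split /= -mulr_suml.
have cnt := @count_exceptional R z N Y K z0 erefl YP.
have var : \sum_(1 <= n < N.+1) \sum_(1 <= m < N.+1)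
    ((line_count z m n)%:R - mean_lines R z) ^+ 2 <= N%:R ^+ 2 * (8 * t%:R) :> R.
  apply: (@le_trans _ _ (\sum_(1 <= n < N.+1) (48 * z%:R ^+ 2 + 4 * N%:R * mean_lines R z))).
    by apply: ler_sum => n _; apply: line_count_variance.
  rewrite sumr_const_nat subn1 -[leLHS]mulr_natr.
  rewrite (_ : N%:R ^+ 2 * _ = N%:R * (8 * t%:R) * N%:R); last by ring.
  rewrite ler_wpM2r //.
  have z2 : z%:R ^+ 2 <= N%:R :> R by rewrite /N natrX ler_weXn2l // ler1n.
  have t13R : 13%:R <= t%:R :> R by rewrite ler_nat.
  case/andP: cz => _ cz.
  have hN := ler_wpM2l (_ : 0 <= 4 * N%:R) cz; rewrite mulr_ge0 // in hN.
  apply: le_trans (lerD (ler_wpM2l _ z2) (hN isT)) _ => //.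
  rewrite (_ : 48 * N%:R + _ = N%:R * (52 + 4 * t%:R)); last by ring.
  by rewrite ler_wpM2l //; lra.
have NR : 0 < N%:R ^+ 2 :> R by rewrite exprn_gt0 // ltr0n.
have e2 : 0 < eta ^+ 2 by rewrite exprn_gt0.
have Y0 : 0 < Y%:R :> R by rewrite ltr0n ltnW.
have bY : 3 / Y%:R <= delta / 4.
  have h := hY; rewrite ler_pdivrMr // in h; rewrite ler_pdivrMr //; lra.
have bK : 2 * Y.+1%:R * (2 ^ K)%:R^-1 <= delta / 4.
  have h : 8 * Y.+1%:R / delta <= (2 ^ K)%:R.
    by apply: le_trans hK _; rewrite ler_nat ltnW // ltn_expl.
  rewrite ler_pdivrMr // in h; rewrite ler_pdivrMr ?ltr0n ?expn_gt0 //; lra.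
have bt : (32 / eta ^+ 2 + 2 + 2 * Y.+1%:R) / t%:R <= delta / 2.
  have h : (32 / eta ^+ 2 + 2 + 2 * Y.+1%:R) * 2 / delta <= t%:R.
    by apply: le_trans ht2 _; rewrite ler_nat.
  rewrite ler_pdivrMr // in h; rewrite ler_pdivrMr //; lra.
have zt : z%:R^-1 <= t%:R^-1 :> R by rewrite lef_pV2 ?posrE ?ltr0n // ler_nat.
have Yzt : 2 * Y.+1%:R * z%:R^-1 <= 2 * Y.+1%:R * t%:R^-1 :> R by rewrite ler_wpM2l ?mulr_ge0.
have vk : N%:R ^+ 2 * (8 * t%:R) / (eta * t%:R / 2) ^+ 2 =
    N%:R ^+ 2 * (32 / eta ^+ 2 / t%:R) by field; rewrite !lt0r_neq0.
have k0 : 0 <= (eta * t%:R / 2) ^+ 2 by rewrite sqr_ge0.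
have := ler_wpM2r (_ : 0 <= ((eta * t%:R / 2) ^+ 2)^-1) var.
rewrite invr_ge0 => /(_ k0) var'.
rewrite vk in var'.
apply: le_trans (lerD var' cnt) _.
rewrite -mulrDr mulrC ler_wpM2r ?(ltW NR) //.
rewrite (mulrDl (32 / _ + 2)) (mulrDl (32 / _)) in bt; rewrite mulrDr.
move: (32 / eta ^+ 2 / t%:R) (2 * Y.+1%:R / t%:R) (2 * Y.+1%:R / z%:R) bt Yzt.
move: (2 * Y.+1%:R / (2 ^ K)%:R) (3 / Y%:R) bK bY (z%:R^-1) zt => *; lra.
Qed.

Local Open Scope classical_set_scope.
Local Open Scope ring_scope.

(** * Small sets of positive measure *)

(** The open balls around x shrink to the singleton of x, which is null. *)
Lemma null_neighborhood (R : realType) (d : measure_display)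
    (X : metricMeasurableType d R) (mu : probability X R) (beta : R) :
  borel_space X -> nonatomic mu -> 0 < beta ->
  forall x : X, exists U, [/\ open U, U x, measurable U & (mu U < beta%:E)%E].
Proof.
move=> bX na b0 x.
have mopen (U : set X) : open U -> measurable U.
  by move=> oU; rewrite bX; exact: sub_sigma_algebra.
pose U (n : nat) : set X := (ball x (n.+1%:R^-1 : R))°.
have oU n : open (U n) by exact: open_interior.
have Ux n : U n x by apply: nbhsx_ballx; rewrite invr_gt0.
have capU : \bigcap_n U n = [set x].
  apply/seteqP; split => [y Uy /=|_ -> n _ //].
  apply/esym/(@metric_hausdorff R X); move=> P Q nP nQ.
  have /nbhs_ballP[r /= r0 rP] := nP; have Qy := nbhs_singleton nQ.
  exists y; split=> //; apply: rP.
  have [n nr] : exists n : nat, n.+1%:R^-1 <= r.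
    exists (Num.bound r^-1); rewrite invf_ple ?posrE //.
    apply: ltW; apply: lt_le_trans (archi_boundP _) _; first by rewrite invr_ge0 ltW.
    by rewrite ler_nat.
  by apply: (le_ball nr); apply: interior_subset; exact: Uy.
have cvgU : mu \o U @ \oo --> (0%E : \bar R).
  rewrite -(na x) -capU; apply: nonincreasing_cvg_mu.
  - exact: le_lt_trans (probability_le1 mu (mopen _ (oU 0%N))) (ltry 1).
  - by move=> i; exact: mopen.
  - by apply: bigcap_measurable => // i _; exact: mopen.
  - move=> m n mn; apply/subsetPset; apply: interiorS; apply: le_ball.
    by rewrite lef_pV2 ?posrE // ler_nat.
have /fine_cvgP[_ ] := cvgU.
move=> /cvgrPdist_lt/(_ beta b0)[n _ /(_ n (leqnn n))] /=.
rewrite sub0r normrN => h; exists (U n); split => //; first exact: mopen.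
have fU : mu (U n) \is a fin_num by apply: fin_num_measure; exact: mopen.
by rewrite -(fineK fU) lte_fin (le_lt_trans (ler_norm _)).
Qed.

(** Otherwise every x has an open neighborhood of measure zero.  The complements
    of null sets would then generate a proper filter without cluster point. *)
Lemma exists_small_set (R : realType) (d : measure_display)
    (X : metricMeasurableType d R) (mu : probability X R) (beta : R) :
  compact [set: X] -> borel_space X -> nonatomic mu -> 0 < beta ->
  exists B : set X, [/\ measurable B, (0 < mu B)%E & (mu B <= beta%:E)%E].
Proof.
move=> cX bX na b0; apply: contrapT => noB.
have null (B : set X) : measurable B -> (mu B < beta%:E)%E -> mu B = 0%E.
  move=> mB Bb; apply/eqP; rewrite eq_le measure_ge0 andbT leNgt; apply/negP => B0.
  by apply: noB; exists B; split=> //; exact: ltW.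
(* By compactness the filter of the sets of full measure has a cluster point. *)
pose F : set_system X := [set S | exists N, [/\ measurable N, mu N = 0%E & ~` N `<=` S]].
have FF : ProperFilter F.
  split.
    move=> [N [mN N0 NS]].
    have NT : N = setT by apply/seteqP; split=> // y _; apply: contrapT => /NS.
    by move: N0; rewrite NT probability_setT => N0; have := @lte01 R; rewrite N0 ltxx.
  split.
  - by exists set0; split=> //; rewrite measure0.
  - move=> P Q [N [mN N0 NP]] [M [mM M0 MQ]]; exists (N `|` M); split.
    + exact: measurableU.
    + by rewrite null_set_setU.
    + by rewrite setCU => y [/NP Py /MQ Qy].
  - by move=> P Q PQ [N [mN N0 NP]]; exists N; split=> //; apply: subset_trans PQ.
have [x [_ clx]] := cX F FF (ltac:(by exists set0; split=> //; rewrite measure0)).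
have [U [oU Ux mU Ub]] := null_neighborhood bX na b0 x.
have [y [nUy Uy]] := clx (~` U) U
  (ltac:(by exists U; split=> //; exact: null)) (ltac:(exact: open_nbhs_nbhs)).
by [].
Qed.

(** * Hitting times and towers *)

Section towers.
Context (R : realType) (d : measure_display) (X : measurableType d).
Variables (mu : probability X R) (T : X -> X).
Hypothesis T_mp : measure_preserving mu T.

Lemma measurable_preimage A : measurable A -> measurable (T @^-1` A).
Proof. by move=> mA; rewrite -[_ @^-1` _]setTI; apply: T_mp.1. Qed.

Lemma iter_preserving n A : measurable A ->
  measurable (iter n T @^-1` A) /\ mu (iter n T @^-1` A) = mu A.
Proof.
move=> mA; elim: n => [//|n [IHm IHmu]].
rewrite (_ : iter n.+1 T @^-1` A = T @^-1` (iter n T @^-1` A)); last first.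
  by apply/seteqP; split=> x /=; rewrite -iterS iterSr.
by split; [exact: measurable_preimage|rewrite T_mp.2].
Qed.

Definition eventually_hits (B : set X) : set X := \bigcup_n (iter n T @^-1` B).

Lemma measurable_eventually_hits B : measurable B -> measurable (eventually_hits B).
Proof. by move=> mB; apply: bigcup_measurable => n _; apply: (iter_preserving n mB).1. Qed.

(** The preimages of the hitting set decrease and have equal measure; their
    intersection is strictly invariant, so ergodicity applies to it. *)
Lemma eventually_hits_full B : ergodic mu T -> measurable B -> (0 < mu B)%E ->
  mu (eventually_hits B) = 1%E.
Proof.
move=> erg mB B0; set U := eventually_hits B.
have mU : measurable U by exact: measurable_eventually_hits.
pose V n := iter n T @^-1` U.
have mV n : measurable (V n) by apply: (iter_preserving n mU).1.
have Vdec n : V n.+1 `<=` V n.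
  by move=> x [k _ h]; exists k.+1 => //=; rewrite -iterS iterSr.
(* The preimage of U lies in U but may be smaller by a null set; I is strictly
   invariant. *)
pose I := \bigcap_n V n.
have mI : measurable I by apply: bigcap_measurable => // n _.
have TI : T @^-1` I = I.
  apply/seteqP; split => [x Ix n _|x Ix n _]; last first.
    by have := Ix n.+1 Logic.I; rewrite /V /= -iterS iterSr.
  by apply: Vdec; rewrite /V /= -iterS iterSr; exact: (Ix n Logic.I).
have muI : mu I = mu U.
  have cI : mu \o V @ \oo --> mu I.
    apply: nonincreasing_cvg_mu => //.
      exact: le_lt_trans (probability_le1 mu (mV 0%N)) (ltry 1).
    by apply/nonincreasing_seqP => n; apply/subsetPset; exact: Vdec.
  have E : mu \o V = cst (mu U).
    by apply/funext => n /=; apply: (iter_preserving n mU).2.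
  rewrite E in cI; exact: (cvg_unique (@ereal_hausdorff R) cI (cvg_cst _)).
have [I0|<-//] := erg I mI TI.
have : (mu B <= mu U)%E by apply: le_measure; rewrite ?inE // => x Bx; exists 0%N.
by rewrite -muI I0 leNgt B0.
Qed.

Definition first_hit_at (B : set X) (i : nat) : set X :=
  [set x | B (iter i T x) /\ forall j, (j < i)%N -> ~ B (iter j T x)].

Lemma measurable_first_hit_at B i : measurable B -> measurable (first_hit_at B i).
Proof.
move=> mB; rewrite (_ : first_hit_at B i =
    (iter i T @^-1` B) `\` \bigcup_(j in [set j | (j < i)%N]) (iter j T @^-1` B)).
  apply: measurableD; first exact: (iter_preserving i mB).1.
  by apply: bigcup_measurable => j _; apply: (iter_preserving j mB).1.
apply/seteqP; split => x [Bx nB]; split=> //.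
  by move=> [j /= ji]; exact: nB.
by move=> j ji Bj; apply: nB; exists j.
Qed.

Lemma first_hit_at_iter B i j x : (j <= i)%N -> first_hit_at B i x -> first_hit_at B (i - j) (iter j T x).
Proof.
move=> ji [Bx nB]; split; first by rewrite -iterD subnK.
by move=> k kij; rewrite -iterD; apply: nB; lia.
Qed.

Lemma first_hit_at_inj B i j x : first_hit_at B i x -> first_hit_at B j x -> i = j.
Proof.
move=> [Bi nBi] [Bj nBj]; apply/eqP; rewrite eqn_leq.
by apply/andP; split; rewrite leqNgt; apply/negP => /[dup] h;
  [move/nBi|move/nBj].
Qed.

Lemma eventually_hitsP B x : eventually_hits B x -> exists i, first_hit_at B i x.
Proof.
move=> [n _ Bn].
have ex : exists n, `[< B (iter n T x) >] by exists n; apply/asboolP.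
case: (ex_minnP ex) => i /asboolP Bi min; exists i; split=> // j ji Bj.
by have := min j (asboolT Bj); rewrite leqNgt ji.
Qed.

(** Indexing by the residue of the first hitting time makes T map level r.+1 into
    level r. *)
Definition tower_level (B : set X) (H r : nat) : set X :=
  \bigcup_q first_hit_at B (q * H + r).

Lemma measurable_tower_level B H r : measurable B -> measurable (tower_level B H r).
Proof. by move=> mB; apply: bigcup_measurable => q _; exact: measurable_first_hit_at. Qed.

Lemma tower_levelS B H r : tower_level B H r.+1 `<=` T @^-1` tower_level B H r.
Proof.
move=> x [q _ hx]; exists q => //=.
by have := @first_hit_at_iter B _ 1 x _ hx; rewrite addnS subn1 /=; apply; lia.
Qed.

(** A point whose first hitting time is a positive multiple of H moves on to the
    top level. *)
Lemma tower_level0 B H : (0 < H)%N ->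
  tower_level B H 0 `<=` B `|` T @^-1` tower_level B H H.-1.
Proof.
move=> H0 x [[|q] _ hx]; first by left; case: hx.
right; exists q => //=.
have := @first_hit_at_iter B _ 1 x _ hx.
by rewrite (_ : q.+1 * H + 0 - 1 = q * H + H.-1)%N /=; [apply; nia|nia].
Qed.

Lemma mu_le_preimage A B : measurable A -> measurable B -> A `<=` T @^-1` B ->
  (mu A <= mu B)%E.
Proof.
move=> mA mB AB; rewrite -(T_mp.2 B mB).
by apply: le_measure; rewrite ?inE //; exact: measurable_preimage.
Qed.

(** The measures of the H disjoint levels are nonincreasing in r by
    [tower_levelS], so the last one is the smallest. *)
Lemma mu_tower_level_top B H : (0 < H)%N -> measurable B ->
  (mu (tower_level B H H.-1) <= (H%:R^-1)%:E)%E.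
Proof.
move=> H0 mB; pose V := tower_level B H.
have mV r : measurable (V r) by exact: measurable_tower_level.
have mono r : (r < H)%N -> (mu (V H.-1) <= mu (V r))%E.
  move=> rH; rewrite (_ : r = H.-1 - (H.-1 - r))%N; last by lia.
  elim: (H.-1 - r)%N => [|k IH]; first by rewrite subn0.
  apply: le_trans IH _; case: (leqP H.-1 k) => hk.
    by rewrite (_ : H.-1 - k.+1 = H.-1 - k)%N //; lia.
  apply: mu_le_preimage => //.
  by rewrite (_ : H.-1 - k = (H.-1 - k.+1).+1)%N; [exact: tower_levelS|lia].
have dis : trivIset [set r | (r < H)%N] V.
  move=> r s /= rH sH [x [[q _ hq] [q' _ hq']]].
  have := first_hit_at_inj hq hq' => /(congr1 (modn^~ H)).
  by rewrite !modnMDl !modn_small.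
have le1 : (\sum_(r < H) mu (V r) <= 1)%E.
  rewrite -(@measure_semi_additive_ord_I _ _ _ mu V H) //.
    by apply: probability_le1; apply: bigsetU_measurable.
  by apply: bigsetU_measurable.
have fV r : mu (V r) \is a fin_num by exact: fin_num_measure.
rewrite -(fineK (fV _)) lee_fin -div1r ler_pdivlMr ?ltr0n // (mulrC (fine _)) mulr_natl.
rewrite -lee_fin EFin_natmul fineK //.
apply: le_trans le1.
rewrite (_ : mu (V H.-1) *+ H = \sum_(r < H) mu (V H.-1))%E; last by rewrite sumr_const card_ord.
by apply: lee_sum => r _; exact: mono.
Qed.
End towers.

(** * Sweeping sets *)

Lemma Omega_average_ge (R : realType) (d : measure_display) (X : measurableType d)
    (T : X -> X) (A : set X) (x : X) (N : nat) (P : nat -> bool) (delta : R) :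
  (0 < N)%N -> (forall k, P k -> A (iter k T x)) ->
  \sum_(1 <= m < N.+1) \sum_(1 <= n < N.+1) (~~ P (Omega (m ^ 2 + n ^ 2)))%:R
    <= delta * N%:R ^+ 2 ->
  1 - delta <= Omega_average T A x N.
Proof.
move=> N0 PA bad; have N2 : 0 < N%:R ^+ 2 :> R by rewrite exprn_gt0 // ltr0n.
rewrite /Omega_average -(ler_pM2l N2) mulVKf ?lt0r_neq0 //.
apply: (@le_trans _ _ (\sum_(1 <= m < N.+1) \sum_(1 <= n < N.+1)
   (1 - (~~ P (Omega (m ^ 2 + n ^ 2)))%:R))); last first.
  apply: ler_sum => m _; apply: ler_sum => n _; rewrite indicE.
  case: (boolP (P _)) => [/PA /mem_set ->|_] /=; first by rewrite subr0.
  by rewrite subrr.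
under eq_bigr do rewrite sumrB sumr_const_nat subn1.
rewrite sumrB sumr_const_nat subn1 /= -mulrnA -[1 *+ (N * N)]/((N * N)%:R) natrM -expr2.
by rewrite mulrBr mulr1 lerD2l lerN2 mulrC.
Qed.

(** With windows of relative size 1 / q around times below H = q * s, a window
    has radius less than s.  For a point of level r >= 3 * s take t = r - s: the window is
    contained in (r - 2 * s, r), and there the orbit is on levels between 0 and
    2 * s, which belong to W.  All levels have measure at most 2 / H, so that mu W <= 6 / q. *)
Lemma sweeping_set (R : realType) (d : measure_display)
    (X : metricMeasurableType d R) (mu : probability X R) (T : X -> X) :
  compact [set: X] -> borel_space X -> measure_preserving mu T ->
  ergodic mu T -> nonatomic mu ->
  forall (e : R) (K : nat), 0 < e ->
  exists (W G : set X) (H : nat),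
    [/\ measurable W, measurable G, (mu W <= e%:E)%E, (mu (~` G) <= e%:E)%E &
      forall x, G x -> exists N, [/\ (K <= N)%N, (0 < N)%N &
        forall A : set X,
          (forall i, (i <= H)%N -> W (iter i T x) -> A (iter i T x)) ->
          1 - e <= Omega_average T A x N]].
Proof.
move=> cX bX mp erg na e K e0.
(* Applied to the tower coordinate r' = r, window radius s' = s and time k' = k. *)
have arith (s' r' u : nat) : (u < s')%N -> (3 * s' <= r')%N -> (u <= r' - s')%N /\ (s' <= r')%N.
  by lia.
have arith' (s' r' k' i' : nat) : (3 * s' <= r')%N -> (k' < r')%N -> (r' < k' + 2 * s')%N ->
  (r' - k' < 3 * s')%N by lia.
have [q [q1 hq]] := exists_nat_ge 1 (6 / e).
have qR : 0 < q%:R :> R by rewrite ltr0n.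
have q0 : 0 < q%:R^-1 :> R by rewrite invr_gt0.
have [t0 NT] := @Omega_sum_sqr_normal_order R q%:R^-1 e q0 e0.
pose s := (maxn t0 K).+1.
pose H := (q * s)%N; pose w := (3 * s)%N.
have H0 : (0 < H)%N by rewrite muln_gt0 q1.
have HR : 0 < H%:R :> R by rewrite ltr0n.
have [B [mB B0 BH]] := @exists_small_set R d X mu H%:R^-1 cX bX na (ltac:(by rewrite invr_gt0)).
pose V r := tower_level T B H r.
have mV r : measurable (V r) by exact: (measurable_tower_level mp _ _ mB).
pose W := \big[setU/set0]_(r < w) V r.
have mW : measurable W by apply: bigsetU_measurable.
pose U := eventually_hits T B.
have mU : measurable U by exact: (measurable_eventually_hits mp mB).
have V0 : (mu (V 0%N) <= (2 / H%:R)%:E)%E.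
  apply: (@le_trans _ _ (mu (B `|` T @^-1` V H.-1))).
    apply: le_measure; rewrite ?inE //; last exact: tower_level0.
    by apply: measurableU => //; exact: (measurable_preimage mp (mV _)).
  apply: (@le_trans _ _ (mu B + mu (T @^-1` V H.-1))%E).
    by apply: measureU2 => //; exact: (measurable_preimage mp (mV _)).
  rewrite mp.2 // mulr2n mulrDl mul1r EFinD leeD //.
  exact: mu_tower_level_top.
have Vr r : (mu (V r) <= (2 / H%:R)%:E)%E.
  elim: r => [//|r IH]; apply: le_trans IH; apply: (mu_le_preimage mp) => //.
  exact: tower_levelS.
have muW : (mu W <= e%:E)%E.
  apply: le_trans (Boole_inequality mu _) _ => //.
  apply: (@le_trans _ _ (\sum_(r < w) (2 / H%:R)%:E)%E); first by apply: lee_sum => r _; exact: Vr.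
  rewrite sumEFin lee_fin sumr_const card_ord -[leLHS]mulr_natr.
  have -> : 2 / H%:R * w%:R = 6 / q%:R :> R.
    rewrite /H /w !natrM; field.
    by rewrite !pnatr_eq0 -lt0n q1.
  by rewrite ler_pdivrMr // mulrC -ler_pdivrMr.
have WV r x : (r < w)%N -> V r x -> W x.
  by move=> rw Vx; rewrite /W -(bigcup_mkord w V); exists r.
exists W, (U `\` W), H; split=> //; first exact: measurableD.
  rewrite setDE setCI setCK; apply: (@le_trans _ _ (mu (~` U) + mu W)%E).
    by apply: measureU2 => //; exact: measurableC.
  by rewrite probability_setC // eventually_hits_full // subee // add0e.
move=> x [Ux nWx].
have [i hi] := eventually_hitsP Ux.
have Ei := divn_eq i H; set r := (i %% H)%N in Ei; set a := (i %/ H)%N in Ei.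
have rH : (r < H)%N by rewrite ltn_pmod.
have Vrx : V r x by exists a => //; rewrite -Ei.
have wr : (w <= r)%N by rewrite leqNgt; apply/negP => /WV /(_ Vrx).
have [t0rs sr] := arith s r t0 (leq_maxl _ _ : t0 < s)%N wr.
have [Krs _] := arith s r K (leq_maxr _ _ : K < s)%N wr.
have [N [tN N0 bad]] := NT (r - s)%N t0rs.
exists N; split=> //; first exact: leq_trans Krs tN.
move=> A WA.
apply: (@Omega_average_ge R d X T A x N
   (fun k => `|k%:R - (r - s)%N%:R| <= q%:R^-1 * (r - s)%N%:R :> R) e N0) => //.
move=> k kclose.
have [kr rk] : (k < r)%N /\ (r < k + 2 * s)%N.
  have tq : q%:R^-1 * (r - s)%N%:R < s%:R :> R.
    rewrite mulrC ltr_pdivrMr // -natrM ltr_nat mulnC.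
    exact: leq_ltn_trans (leq_subr _ _) rH.
  have := le_lt_trans kclose tq; rewrite ltr_norml natrB // => /andP[h1 h2].
  by split; rewrite -(ltr_nat R) ?natrD ?natrM; lra.
apply: WA; first by apply: ltnW; exact: ltn_trans rH.
apply: (@WV (r - k)%N); first exact: arith' rk.
exists a => //; have ki : (k <= i)%N.
  by apply: leq_trans (ltnW kr) _; exact: leq_mod.
have := @first_hit_at_iter _ _ T B i k x ki hi.
by rewrite {1}Ei addnBA // ltnW.
Qed.

(** * Averages and upper limits *)

Lemma limn_esup_eq (R : realType) (u : nat -> R) (c : R) :
  (forall n, u n <= c) ->
  (forall (e : R) (K : nat), 0 < e -> exists N, (K <= N)%N /\ c - e <= u N) ->
  limn_esup (fun n => (u n)%:E) = c%:E.
Proof.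
move=> uc often; have supE n : ereal_sup (sdrop (fun n => (u n)%:E) n) = c%:E.
  apply/eqP; rewrite eq_le; apply/andP; split.
    by apply: ge_ereal_sup => _ [k _ <-]; rewrite lee_fin.
  apply/lee_addgt0Pr => e e0; have [N [nN h]] := often e n e0.
  apply: (@le_trans _ _ ((u N)%:E + e%:E)%E).
    by rewrite -EFinD lee_fin -lerBlDr.
  by rewrite leeD2r //; apply: ereal_sup_ubound; exists N.
rewrite limn_esup_lim; apply: cvg_lim => //.
rewrite (_ : esups _ = cst c%:E); first exact: cvg_cst.
by apply/funext => n; rewrite /esups /= supE.
Qed.

Lemma Omega_average_bounds (R : realType) (d : measure_display)
    (X : measurableType d) (T : X -> X) (A : set X) (x : X) (N : nat) :
  0 <= (Omega_average T A x N : R) <= 1.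
Proof.
have i01 y : 0 <= (\1_A y : R) <= 1 by rewrite indicE; case: (y \in A) => /=; lra.
case: (posnP N) => [->|N0].
  by rewrite /Omega_average big_geq // mulr0 lexx ler01.
have N2 : 0 < N%:R ^+ 2 :> R by rewrite exprn_gt0 // ltr0n.
apply/andP; split.
  rewrite /Omega_average mulr_ge0 ?invr_ge0 ?(ltW N2) //.
  by apply: sumr_ge0 => m _; apply: sumr_ge0 => n _; have /andP[] := i01 (iter (Omega (m ^ 2 + n ^ 2)) T x).
rewrite /Omega_average mulrC ler_pdivrMr // mul1r.
apply: (@le_trans _ _ (\sum_(1 <= m < N.+1) \sum_(1 <= n < N.+1) 1)).
  by apply: ler_sum => m _; apply: ler_sum => n _; have /andP[] := i01 (iter (Omega (m ^ 2 + n ^ 2)) T x).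
by rewrite !sumr_const_nat subn1 /= -mulrnA -[1 *+ (N * N)]/((N * N)%:R) natrM -expr2.
Qed.

Lemma Omega_averageC (R : realType) (d : measure_display) (X : measurableType d)
    (T : X -> X) (A : set X) (x : X) (N : nat) : (0 < N)%N ->
  Omega_average T (~` A) x N = 1 - Omega_average T A x N :> R.
Proof.
move=> N0; have N2 : N%:R ^+ 2 != 0 :> R by rewrite expf_neq0 // pnatr_eq0 -lt0n.
rewrite /Omega_average -[X in X - _](mulVf N2) -mulrBr; congr (_ * _).
rewrite expr2 -natrM -[(N * N)%:R]/(1 *+ (N * N)) mulrnA.
rewrite -[X in X - _](_ : \sum_(1 <= m < N.+1) \sum_(1 <= n < N.+1) 1 = _); last first.
  by rewrite !sumr_const_nat subn1.
rewrite -sumrB; apply: eq_bigr => m _; rewrite -sumrB; apply: eq_bigr => n _.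
rewrite !indicE in_setC; case: (_ \in A) => /=; lra.
Qed.

(** The measures are dominated by a geometric series of ratio 1 / 2. *)
Lemma tail_union_measure (R : realType) (d : measure_display) (X : measurableType d)
    (mu : probability X R) (W : nat -> set X) (e : nat -> R) (k : nat) :
  (forall j, measurable (W j)) -> (forall j, (mu (W j) <= (e j)%:E)%E) ->
  (forall j, 0 <= e j) -> (forall j, e j.+1 <= e j / 2) ->
  (mu (\bigcup_(j in [set j | (k <= j)%N]) W j) <= (2 * e k)%:E)%E.
Proof.
move=> mW We e0 e2.
have sub : \bigcup_(j in [set j | (k <= j)%N]) W j `<=` \bigcup_(j in ~` `I_k) W j.
  by move=> x [j /= kj Wx]; exists j => //=; apply/negP; rewrite -leqNgt.
apply: le_trans (measure_sigma_subadditive_tail mu mW _ sub) _.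
  by apply: bigcup_measurable => j _.
apply: lime_le; first by apply: is_cvg_nneseries => j _ _; exact: measure_ge0.
near=> n.
apply: (@le_trans _ _ (\sum_(k <= j < n) (e j)%:E)%E); first by apply: lee_sum => j _; exact: We.
rewrite sumEFin lee_fin.
have kn : (k <= n)%N by near: n; exact: nbhs_infty_ge.
(* The summand 2 * e n, which bounds the rest of the series, makes the bound
   inductive. *)
suff : \sum_(k <= j < n) e j <= 2 * e k - 2 * e n.
  by move=> /le_trans; apply; rewrite lerBlDr lerDl mulr_ge0.
rewrite -(subnK kn); elim: (n - k)%N => [|l IH]; first by rewrite add0n big_geq ?subrr.
rewrite addSn big_nat_recr ?leq_addl //=.
have := e2 (l + k)%N; have := IH; lra.
Unshelve. all: by end_near.
Qed.

(** * Gluing sweeping sets *)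

Section gluing.
Context (R : realType) (d : measure_display) (X : measurableType d).
Variables (mu : probability X R) (T : X -> X).
Hypothesis T_mp : measure_preserving mu T.
Variables (W G : nat -> set X) (H : nat -> nat) (e : nat -> R).
Hypothesis mW : forall k, measurable (W k).
Hypothesis mG : forall k, measurable (G k).
Hypothesis muW : forall k, (mu (W k) <= (e k)%:E)%E.
Hypothesis muG : forall k, (mu (~` G k) <= (e k)%:E)%E.
Hypothesis e0 : forall k, 0 < e k.
Hypothesis eS : forall k, e k.+1 * (4 * (H k).+1%:R) <= e k.
Hypothesis GW : forall k x, G k x -> exists N, [/\ (k <= N)%N, (0 < N)%N &
  forall A : set X, (forall i, (i <= H k)%N -> W k (iter i T x) -> A (iter i T x)) ->
  1 - e k <= Omega_average T A x N].

Let e2 k : e k.+1 <= e k / 2.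
Proof.
have := eS k; have := e0 k.+1; have : 1 <= (H k).+1%:R :> R by rewrite ler1n.
nra.
Qed.

Let e_ge0 k : 0 <= e k. Proof. exact: ltW. Qed.

Definition later (k : nat) : set X := \bigcup_(j in [set j | (k < j)%N]) W j.

(** A point lying in several of the W k is decided by the last of them: the
    later sets are much smaller and so undo little of what the earlier ones
    achieve. *)
Definition glued : set X := \bigcup_(k in [set k | ~~ odd k]) (W k `\` later k).

Let mlater k : measurable (later k).
Proof. by apply: bigcup_measurable. Qed.

Lemma measurable_glued : measurable glued.
Proof. by apply: bigcup_measurable => k _; apply: measurableD. Qed.

Lemma glued_measure : (mu glued <= (2 * e 0%N)%:E)%E.
Proof.
apply: le_trans (@tail_union_measure _ _ _ mu W e 0 mW muW e_ge0 e2).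
apply: le_measure; rewrite ?inE; first exact: measurable_glued.
  by apply: bigcup_measurable.
by move=> x [k _ [Wx _]]; exists k.
Qed.

Definition spoiled (k : nat) : set X :=
  ~` G k `|` \bigcup_(i in [set i | (i <= H k)%N]) (iter i T @^-1` later k).

Lemma measurable_spoiled k : measurable (spoiled k).
Proof.
apply: measurableU; first exact: measurableC.
by apply: bigcup_measurable => i _; apply: (iter_preserving T_mp i (mlater k)).1.
Qed.

(** The union of the later sets has measure at most 2 * e k.+1, and e k.+1 was
    chosen to absorb the factor (H k).+1. *)
Lemma spoiled_measure k : (mu (spoiled k) <= (2 * e k)%:E)%E.
Proof.
pose P := \bigcup_(i in [set i | (i <= H k)%N]) (iter i T @^-1` later k).
have mP : measurable P.
  by apply: bigcup_measurable => i _; apply: (iter_preserving T_mp i (mlater k)).1.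
apply: (@le_trans _ _ (mu (~` G k) + mu P)%E).
  by apply: measureU2 => //; exact: measurableC.
rewrite mulr2n mulrDl mul1r EFinD leeD //.
have -> : P = \big[setU/set0]_(i < (H k).+1) (iter i T @^-1` later k).
  by rewrite -(bigcup_mkord (H k).+1 (fun i => iter i T @^-1` later k)).
have mpre i : measurable (iter i T @^-1` later k) by apply: (iter_preserving T_mp i (mlater k)).1.
have mupre i : (mu (iter i T @^-1` later k) <= (2 * e k.+1)%:E)%E.
  rewrite (iter_preserving T_mp i (mlater k)).2.
  exact: (@tail_union_measure _ _ _ mu W e k.+1 mW muW e_ge0 e2).
apply: le_trans (@Boole_inequality _ _ _ mu (fun i => iter i T @^-1` later k) _ (fun i _ => mpre i)) _.
apply: (@le_trans _ _ (\sum_(i < (H k).+1) (2 * e k.+1)%:E)%E).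
  by apply: lee_sum => i _; exact: mupre.
rewrite sumEFin lee_fin sumr_const card_ord -[leLHS]mulr_natr.
have := eS k; have := e0 k; nra.
Qed.

(** Along the relevant times membership in W k entails membership in the glued
    set, for no later set interferes. *)
Lemma glued_average_ge k x : ~ spoiled k x -> ~~ odd k ->
  exists N, (k <= N)%N /\ 1 - e k <= Omega_average T glued x N.
Proof.
move=> nsp ek.
have Gx : G k x by apply: contrapT => nG; apply: nsp; left.
have [N [kN N0 h]] := GW Gx; exists N; split=> //; apply: h => i iH Wi.
by exists k => //; split=> // l; apply: nsp; right; exists i.
Qed.

(** Along the relevant times a point of W k is outside the glued set: its last
    index is k, which is odd. *)
Lemma glued_average_le k x : ~ spoiled k x -> odd k ->
  exists N, (k <= N)%N /\ Omega_average T glued x N <= e k.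
Proof.
move=> nsp ok.
have Gx : G k x by apply: contrapT => nG; apply: nsp; left.
have [N [kN N0 h]] := GW Gx; exists N; split=> //.
suff : 1 - e k <= Omega_average T (~` glued) x N.
  by rewrite Omega_averageC // lerD2l lerN2.
apply: h => i iH Wi [j /= ej [Wj nl]].
case: (ltngtP j k) => [jk|kj|jk].
- by apply: nl; exists k.
- by apply: nsp; right; exists i => //; exists j.
- by move: ej; rewrite jk ok.
Qed.

Lemma e_small (c : R) (K : nat) : 0 < c -> exists k0, forall k, (k0 <= k)%N -> e k <= c.
Proof.
move=> c0; have [k0 [_ hk0]] := exists_nat_ge 0 (e 0%N / c); exists k0 => k hk.
have ek : e k * k.+1%:R <= e 0%N.
  elim: (k) => [|l IH]; first by rewrite mulr1.
  apply: le_trans IH; apply: (@le_trans _ _ (e l / 2 * l.+2%:R)); first by rewrite ler_wpM2r.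
  rewrite -mulrA ler_wpM2l // mulrC ler_pdivrMr // -natrM ler_nat; lia.
have kb : e 0%N / c <= k.+1%:R.
  by apply: le_trans hk0 _; rewrite ler_nat leqW.
rewrite ler_pdivrMr // mulrC in kb.
by rewrite -(ler_pM2r (ltr0Sn R k)); apply: le_trans kb.
Qed.

Lemma glued_limits : {ae mu, forall x : X,
  limn_esup (fun N => (Omega_average T glued x N : R)%:E) = 1%E /\
  limn_einf (fun N => (Omega_average T glued x N : R)%:E) = 0%E}.
Proof.
exists (lim_sup_set spoiled); split.
- apply: bigcap_measurable => // k _; apply: bigcup_measurable => j _.
  exact: measurable_spoiled.
- apply: lim_sup_set_cvg0; first exact: measurable_spoiled.
  apply: (@le_lt_trans _ _ (4 * e 0%N)%:E); last exact: ltry.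
  apply: lime_le; first by apply: is_cvg_nneseries => j _ _; exact: measure_ge0.
  apply: nearW => n.
  apply: (@le_trans _ _ (\sum_(0 <= j < n) (2 * e j)%:E)%E).
    by apply: lee_sum => j _; exact: spoiled_measure.
  rewrite sumEFin lee_fin -mulr_sumr.
  suff : \sum_(0 <= j < n) e j <= 2 * e 0%N - 2 * e n.
    by have := e0 n; lra.
  elim: n => [|n IH]; first by rewrite big_geq ?subrr.
  by rewrite big_nat_recr //=; have := e2 n; lra.
move=> x /= nlim; apply: contrapT => nsup; apply: nlim.
have [k0 good] : exists k0, forall k, (k0 <= k)%N -> ~ spoiled k x.
  apply: contrapT => nk; apply: nsup => k _; apply: contrapT => nb; apply: nk.
  by exists k => j kj sj; apply: nb; exists j.
have bds N := @Omega_average_bounds R d X T glued x N.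
split.
  apply: limn_esup_eq => [N|c K c0]; first by have /andP[] := bds N.
  have [k1 small] := e_small 0 c0.
  pose k := (maxn K (maxn k0 k1)).*2.
  have [N [kN h]] := @glued_average_ge k x (ltac:(apply: good; lia)) (ltac:(by rewrite odd_double)).
  exists N; split; first by lia.
  by apply: le_trans h; rewrite lerD2l lerN2; apply: small; lia.
rewrite -[LHS]oppeK -limn_esupN (_ : _ \o _ = fun N => (- Omega_average T glued x N : R)%:E) //.
rewrite (@limn_esup_eq R _ 0) ?oppe0 // => [N|c K c0].
  by rewrite oppr_le0; have /andP[] := bds N.
have [k1 small] := e_small 0 c0.
pose k := (maxn K (maxn k0 k1)).*2.+1.
have [N [kN h]] := @glued_average_le k x (ltac:(apply: good; lia)) (ltac:(by rewrite /= odd_double)).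
exists N; split; first by lia.
by rewrite sub0r lerN2; apply: le_trans h _; apply: small; lia.
Qed.
End gluing.

Theorem theorem3p10 (R : realType) (d : measure_display)
    (X : metricMeasurableType d R) (mu : probability X R) (T : X -> X)
    (X_compact : compact [set: X]) (X_borel : borel_space X)
    (T_mp : measure_preserving mu T) (T_inv : invertible T)
    (T_erg : ergodic mu T) (mu_nonatomic : nonatomic mu)
    (eps : R) (eps_gt0 : 0 < eps) :
  exists A : set X,
    [/\ measurable A, (mu A < eps%:E)%E &
        {ae mu, forall x : X,
           limn_esup (fun N => (Omega_average T A x N : R)%:E) = 1%E /\
           limn_einf (fun N => (Omega_average T A x N : R)%:E) = 0%E}].
Proof.
have /choice[F hF] : forall p : R * nat, exists F : set X * set X * nat, 0 < p.1 ->
    [/\ measurable F.1.1, measurable F.1.2, (mu F.1.1 <= p.1%:E)%E,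
      (mu (~` F.1.2) <= p.1%:E)%E &
      forall x, F.1.2 x -> exists N, [/\ (p.2 <= N)%N, (0 < N)%N &
        forall A : set X, (forall i, (i <= F.2)%N ->
           F.1.1 (iter i T x) -> A (iter i T x)) ->
          1 - p.1 <= Omega_average T A x N]].
  move=> [e k] /=.
  have [e0|] := pselect (0 < e); last by move=> ne; exists (set0, set0, 0%N).
  have [W [G [H h]]] := @sweeping_set R d X mu T X_compact X_borel T_mp T_erg mu_nonatomic e k e0.
  by exists (W, G, H).
(* The next tolerance depends on the time horizon of the set chosen before. *)
pose e := fix e k : R := if k is k'.+1 then
  e k' / (4 * (F (e k', k')).2.+1%:R) else eps / 4.
have e0 k : 0 < e k.
  elim: k => [|k IH] /=; first by rewrite divr_gt0.
  by rewrite divr_gt0 // mulr_gt0.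
have h k := hF (e k, k) (e0 k).
pose W k := (F (e k, k)).1.1; pose G k := (F (e k, k)).1.2; pose H k := (F (e k, k)).2.
have mW k : measurable (W k) by case: (h k).
have mG k : measurable (G k) by case: (h k).
have muW k : (mu (W k) <= (e k)%:E)%E by case: (h k).
have muG k : (mu (~` G k) <= (e k)%:E)%E by case: (h k).
have eS k : e k.+1 * (4 * (H k).+1%:R) <= e k.
  by rewrite /= -/(H k) divfK // mulf_neq0 // pnatr_eq0.
have GW k x : G k x -> exists N, [/\ (k <= N)%N, (0 < N)%N &
    forall A : set X, (forall i, (i <= H k)%N -> W k (iter i T x) -> A (iter i T x)) ->
    1 - e k <= Omega_average T A x N].
  by case: (h k) => _ _ _ _; apply.
exists (glued W); split.
- exact: (measurable_glued mW).
- apply: le_lt_trans (glued_measure mW muW e0 eS) _.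
  by rewrite lte_fin /=; lra.
- exact: (glued_limits T_mp mW mG muW muG e0 eS GW).
Qed.
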